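(* Let $k$ be an integer with $k>n/2$. Let $a:\overline\Omega\times\mathcal I\to\mathbb C$ be such that $$|\partial_x^\alpha a(x,\xi)|\le C\quad\text{for all }(x,\xi)\in\overline\Omega\times\mathcal I$$ and all multi-indices $\alpha$ with $|\alpha|\le k$. Then the operator $\mathrm{Op}_{\mathrm L}(a)$ extends to a bounded operator from $L^2(\Omega)$ to $L^2(\Omega)$.
   Context: Setting. $\Omega\subset\mathbb R^n$ ($n\ge 1$) is a bounded open set. $\mathrm L$ is a differential operator of order $m$ with smooth coefficients in $\Omega$, equipped with linear boundary conditions (the functions satisfying them form a linear space), viewed as an operator in $L^2(\Omega)$ with domain $\mathrm{Dom}(\mathrm L)$; $\mathrm L^*$ is its adjoint, with the adjoint boundary conditions and domain $\mathrm{Dom}(\mathrm L^* )$. $\mathcal I$ is a countable subset of some $\mathbb Z^K$; $\mathrm L$ has discrete spectrum $\{\lambda_\xi\}_{\xi\in\mathcal I}\subset\mathbb C$, listed with multiplicities so that $|\lambda_j|\le|\lambda_k|$ whenever $|j|\le|k|$. There are eigenfunctions $u_\xi\in\mathrm{Dom}(\mathrm L)$, $\mathrm Lu_\xi=\lambda_\xi u_\xi$, and $v_\xi\in\mathrm{Dom}(\mathrm L^* )$, $\mathrm L^*v_\xi=\overline{\lambda_\xi}v_\xi$, with $\|u_\xi\|_{L^2}=1$ and $(u_\xi,v_\eta)_{L^2}=\delta_{\xi\eta}$, where $(f,g)_{L^2}=\int_\Omega f\overline g\,dx$; both $\{u_\xi\}$ and $\{v_\xi\}$ are Riesz bases of $L^2(\Omega)$.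 Put $\langle\xi\rangle=(1+|\lambda_\xi|^2)^{1/(2m)}$. It is assumed that $\sum_{\xi\in\mathcal I}\langle\xi\rangle^{-s_0}<\infty$ for some $s_0\in\mathbb R$. Test functions: $C^\infty_{\mathrm L}(\overline\Omega)=\bigcap_{k\ge1}\mathrm{Dom}(\mathrm L^k)$, where $\mathrm{Dom}(\mathrm L^k)=\{f\in L^2(\Omega):\mathrm L^jf\in\mathrm{Dom}(\mathrm L),\ j=0,\dots,k-1\}$, with the topology of the norms $\max_{j\le k}\|\mathrm L^j\varphi\|_{L^2}$; $C^\infty_{\mathrm L^*}(\overline\Omega)$ is defined likewise from $\mathrm L^*$. Both are assumed closed under limits in these topologies (Fréchet spaces). WZ assumption: $u_\xi,v_\xi$ have no zeros on $\overline\Omega$ for all $\xi\in\mathcal I$, and there are $C>0,N\ge0$ with $\inf_\Omega|u_\xi|\ge C\langle\xi\rangle^{-N}$ and $\inf_\Omega|v_\xi|\ge C\langle\xi\rangle^{-N}$ as $|\xi|\to\infty$. For $f\in C^\infty_{\mathrm L}(\overline\Omega)$: $\widehat f(\xi)=\int_\Omega f\,\overline{v_\xi}\,dx$ and $\mathrm{Op}_{\mathrm L}(a)f(x)=\sum_{\xi\in\mathcal I}u_\xi(x)\,a(x,\xi)\,\widehat f(\xi)$.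
   Formalization: The bounds on ∂_x^α a are assumed for a C^k extension of a(·,ξ) to an open neighbourhood of the closure of Ω, with neighbourhood and constant C independent of ξ; with bounds on the closure alone the claim fails for some bounded open Ω. *)

(* Defs.v *)
From HB Require Import structures.
From mathcomp Require Import all_boot all_order all_algebra.
From mathcomp Require Import finmap.
From mathcomp Require Import complex.
From mathcomp Require Import all_classical all_reals all_analysis.

Set Implicit Arguments.
Unset Strict Implicit.
Unset Printing Implicit Defensive.

Import Order.TTheory GRing.Theory Num.Theory.
Import numFieldNormedType.Exports.

Local Open Scope classical_set_scope.
Local Open Scope ring_scope.

(* The sigma-algebra generated by the coordinates; for T = R it consists of the
   Borel sets. *)
Section measurable_rV.
Context {d : measure_display} {T : measurableType d}.
Variable n : nat.

Definition rV_coord (i : 'I_n) (x : 'rV[T]_n) : T := x ord0 i.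

Let rV_set0 : g_sigma_preimage rV_coord set0.
Proof. exact: sigma_algebra0. Qed.

Let rV_setC A : g_sigma_preimage rV_coord A -> g_sigma_preimage rV_coord (~` A).
Proof. exact: sigma_algebraC. Qed.

Let rV_bigcup (F : (set 'rV[T]_n)^nat) :
  (forall i, g_sigma_preimage rV_coord (F i)) ->
  g_sigma_preimage rV_coord (\bigcup_i (F i)).
Proof. exact: sigma_algebra_bigcup. Qed.

HB.instance Definition _ := @isMeasurable.Build (measure_tuple_display d)
  'rV[T]_n (g_sigma_preimage rV_coord) rV_set0 rV_setC rV_bigcup.

End measurable_rV.

Section measurable_rV_cons_section.
Context {d : measure_display} {T : measurableType d}.
Variable n : nat.

Definition rV_cons (p : T * 'rV[T]_n) : 'rV[T]_n.+1 :=
  \row_i oapp (fun j => p.2 ord0 j) p.1 (unlift ord0 i).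

Lemma measurable_rV_coord (i : 'I_n) : measurable_fun setT (@rV_coord d T n i).
Proof.
move=> _ Y mY; rewrite setTI; apply: sub_sigma_algebra => /=.
rewrite -bigcup_seq/=; exists i => /=; first by rewrite mem_index_enum.
by exists Y => //; rewrite setTI.
Qed.

Lemma measurable_fun_rV d1 (T1 : measurableType d1) (f : T1 -> 'rV[T]_n) :
  (forall i, measurable_fun setT (@rV_coord d T n i \o f)) ->
  measurable_fun setT f.
Proof.
move=> mf; suff: g_sigma_preimage (fun i => @rV_coord d T n i \o f) `<=` measurable.
  move=> h; rewrite g_sigma_preimage_comp in h => _ A mA.
  by apply: h; exists A.
apply: smallest_sub; first exact: sigma_algebra_measurable.
rewrite -bigcup_seq; apply: bigcup_sub => i _.
by move=> A [B mB <-]; exact: mf.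
Qed.

End measurable_rV_cons_section.

Lemma measurable_rV_cons d (T : measurableType d) n :
  measurable_fun setT (@rV_cons d T n).
Proof.
apply: measurable_fun_rV => i.
case: (unliftP ord0 i) => [j|] ->.
  rewrite (_ : _ \o _ = @rV_coord d T n j \o snd); last first.
    by apply/funext => x; rewrite /rV_coord /rV_cons/= mxE liftK.
  apply: measurableT_comp => //; exact: measurable_rV_coord.
rewrite (_ : _ \o _ = fst) //.
by apply/funext => x; rewrite /rV_coord /rV_cons/= mxE unlift_none.
Qed.

Section lebesgue_step.
Local Open Scope ereal_scope.
Context {R : realType} {n : nat}.
Variable mu : {sigma_finite_measure set 'rV[R]_n -> \bar R}.

Definition lebesgue_rV_step : set 'rV[R]_n.+1 -> \bar R :=
  pushforward (@lebesgue_measure R \x mu) (@rV_cons _ R n).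

Let step0 : lebesgue_rV_step set0 = 0.
Proof. by rewrite /lebesgue_rV_step/pushforward preimage_set0 measure0. Qed.

Let step_ge0 A : 0 <= lebesgue_rV_step A.
Proof. by rewrite /lebesgue_rV_step/pushforward measure_ge0. Qed.

Let mstep A : measurable A -> measurable (@rV_cons _ R n @^-1` A).
Proof.
by move=> mA; rewrite -[X in measurable X]setTI; exact: measurable_rV_cons.
Qed.

Let step_sigma_additive : semi_sigma_additive lebesgue_rV_step.
Proof.
move=> F mF tF mUF; rewrite /lebesgue_rV_step/pushforward preimage_bigcup.
apply: measure_semi_sigma_additive.
- by move=> k; exact: mstep.
- apply/trivIsetP => /= i j _ _ ij; rewrite -preimage_setI.
  by move/trivIsetP : tF => /(_ _ _ _ _ ij) ->//; rewrite preimage_set0.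
- by rewrite -preimage_bigcup; exact: mstep.
Qed.

HB.instance Definition _ := isMeasure.Build _ _ _ lebesgue_rV_step
  step0 step_ge0 step_sigma_additive.

Let uncons (x : 'rV[R]_n.+1) : R * 'rV[R]_n :=
  (x ord0 ord0, \row_j x ord0 (lift ord0 j)).

Let uncons_cons p : uncons (rV_cons p) = p.
Proof.
case: p => a v; rewrite /uncons /rV_cons /= !mxE unlift_none/=; congr pair.
by apply/rowP => j; rewrite !mxE liftK.
Qed.

Let measurable_uncons : measurable_fun setT uncons.
Proof.
apply/measurable_fun_pairP; split.
  exact: (@measurable_rV_coord _ R n.+1 ord0).
apply: measurable_fun_rV => i.
rewrite (_ : _ \o _ = @rV_coord _ R n.+1 (lift ord0 i)).
  exact: measurable_rV_coord.
by apply/funext => x; rewrite /rV_coord /= mxE.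
Qed.

Let step_sigma_finite : sigma_finite setT lebesgue_rV_step.
Proof.
have /sigma_finiteP[F [TF ndF Foo]] := sigma_finiteT (@lebesgue_measure R).
have /sigma_finiteP[G [TG ndG Goo]] := sigma_finiteT mu.
exists (fun k => uncons @^-1` (F k `*` G k)).
  rewrite -preimage_bigcup (_ : \bigcup_k (F k `*` G k) = setT)//.
  rewrite -setXTT TF TG predeqE => -[x y]; split.
    by move=> [i _ []/= ? ?]; split; exists i.
  move=> [/= [i _ Fx] [k _ Gy]]; exists (maxn i k) => //; split.
  - by move: x Fx; exact/subsetPset/ndF/leq_maxl.
  - by move: y Gy; exact/subsetPset/ndG/leq_maxr.
move=> k; have [mF Fk] := Foo k; have [mG Gk] := Goo k; split.
  rewrite -[X in measurable X]setTI; apply: measurable_uncons => //.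
  exact: measurableX.
rewrite /lebesgue_rV_step /pushforward -comp_preimage.
rewrite (_ : uncons \o _ = id); last by apply/funext => p /=; rewrite uncons_cons.
by rewrite preimage_id product_measure1E// lte_mul_pinfty// ge0_fin_numE.
Qed.

HB.instance Definition _ := Measure_isSigmaFinite.Build _ _ _ lebesgue_rV_step
  step_sigma_finite.

End lebesgue_step.

Fixpoint lebesgue_rV (R : realType) (n : nat) :
    {sigma_finite_measure set 'rV[R]_n -> \bar R} :=
  if n is n'.+1 return {sigma_finite_measure set 'rV[R]_n -> \bar R}
  then lebesgue_rV_step (lebesgue_rV R n')
  else \d_(0 : 'rV[R]_0).

Lemma lebesgue_rV_box (R : realType) n (A : 'I_n -> set R) :
  (forall i, measurable (A i)) ->
  (lebesgue_rV R n [set x | forall i, A i (x ord0 i)] =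
   \prod_(i < n) lebesgue_measure (A i))%E.
Proof.
elim: n A => [|n IHn] A mA.
  rewrite big_ord0 /= diracE mem_set//= => -[]//.
have mbox : measurable [set x : 'rV[R]_n | forall i, A (lift ord0 i) (x ord0 i)].
  rewrite (_ : mkset _ =
      \big[setI/setT]_(i < n) (@rV_coord _ R n i @^-1` A (lift ord0 i))).
    apply: bigsetI_measurable => i _; rewrite -[X in measurable X]setTI.
    exact: measurable_rV_coord.
  apply/seteqP; split => x; rewrite -bigcap_seq/=.
    by move=> Ax i _; exact: Ax.
  by move=> Ax i; apply: Ax; rewrite /= mem_index_enum.
rewrite big_ord_recl -IHn// -[RHS](@product_measure1E _ _ _ _ _
  (@lebesgue_measure R) (lebesgue_rV R n) _ _ (mA ord0) mbox).
rewrite /= /lebesgue_rV_step /pushforward; congr (_ _).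
apply/seteqP; split => -[x y] /=.
  move=> Axy; split; first by have := Axy ord0; rewrite mxE unlift_none.
  by move=> i; have := Axy (lift ord0 i); rewrite mxE liftK.
move=> [Ax Ay] i; rewrite mxE.
by case: (unliftP ord0 i) => [j|] ->.
Qed.

Section function_spaces.
Variables (R : realType) (n : nat).
Local Notation C := R[i].
Local Notation X := 'rV[R]_n.
Local Notation mu := (lebesgue_rV R n).
Local Notation re := (@complex.Re R).
Local Notation im := (@complex.Im R).

Definition cabs (z : C) : R := ComplexField.Normc.normc z.

Definition cintegral (D : set X) (f : X -> C) : C :=
  (\int[mu]_(x in D) re (f x) +i* \int[mu]_(x in D) im (f x))%C.

(* Functions representing elements of L^2(Omega): equality in L^2(Omega) is
   [eqae], and values outside Omega are irrelevant. *)
Definition L2 (Omega : set X) : set (X -> C) :=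
  [set f : X -> C | [/\ measurable_fun Omega (re \o f),
               measurable_fun Omega (im \o f) &
               (\int[mu]_(x in Omega) (cabs (f x) ^+ 2)%:E < +oo)%E]].

Definition L2norm (Omega : set X) (f : X -> C) : R :=
  Num.sqrt (\int[mu]_(x in Omega) (cabs (f x) ^+ 2))%R.

Definition L2inner (Omega : set X) (f g : X -> C) : C :=
  cintegral Omega (fun x => f x * (g x)^*%C).

Definition eqae (Omega : set X) (f g : X -> C) : Prop :=
  ae_eq mu Omega f g.

Definition basis_vec (i : 'I_n) : X := delta_mx ord0 i.

Definition cpartial (i : 'I_n) (f : X -> C) : X -> C := fun x =>
  ('D_(basis_vec i) (re \o f) x +i* 'D_(basis_vec i) (im \o f) x)%C.

Definition multi_partial (alpha : 'I_n -> nat) (f : X -> C) : X -> C :=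
  foldr (fun i g => iter (alpha i) (cpartial i) g) f (enum 'I_n).

Definition mi_size (alpha : 'I_n -> nat) : nat := \sum_(i < n) alpha i.

Fixpoint real_Ck (k : nat) (U : set X) (f : X -> R) : Prop :=
  (forall x, U x -> {for x, continuous f}) /\
  (if k is k'.+1 then
     forall i, (forall x, U x -> derivable f x (basis_vec i)) /\
               real_Ck k' U (fun x => 'D_(basis_vec i) f x)
   else True).

Definition complex_Ck (k : nat) (U : set X) (f : X -> C) : Prop :=
  real_Ck k U (re \o f) /\ real_Ck k U (im \o f).

Definition smooth (U : set X) (f : X -> C) : Prop :=
  forall k, complex_Ck k U f.

Definition test_function (Omega : set X) (phi : X -> C) : Prop :=
  smooth setT phi /\
  exists2 A : set X, compact A /\ A `<=` Omega & forall x, ~ A x -> phi x = 0.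

(* |\partial_x^alpha a(x, xi)| <= M for x in the closed set F, xi in I and
   |alpha| <= k. A function on F has derivatives up to the boundary of F as the
   restriction of a C^k function on an open U containing F; both U and the bound
   M over U are uniform in xi. Only the values of a on F matter. *)
Definition bounded_in_Ck (Xi : Type) (I : set Xi) (k : nat) (F : set X)
    (a : X -> Xi -> C) : Prop :=
  exists (U : set X) (b : X -> Xi -> C) (M : R),
    [/\ open U, F `<=` U,
        forall x xi, F x -> I xi -> b x xi = a x xi,
        forall xi, I xi -> complex_Ck k U (b ^~ xi) &
        forall (alpha : 'I_n -> nat) x xi, (mi_size alpha <= k)%N ->
          U x -> I xi -> cabs (multi_partial alpha (b ^~ xi) x) <= M].

End function_spaces.

Section operators.
Variables (R : realType) (n : nat).
Local Notation C := R[i].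
Local Notation X := 'rV[R]_n.
Variable Omega : set X.
Local Notation "f =ae g" := (eqae Omega f g) (at level 70).

(* A possibly unbounded operator; [op_fun] is only meaningful on [op_dom]. *)
Record operator := Operator {
  op_dom : set (X -> C);
  op_fun :> (X -> C) -> (X -> C) }.

Definition linear_operator_on (D : set (X -> C)) (T : (X -> C) -> (X -> C)) :=
  [/\ D `<=` L2 Omega, forall f, D f -> L2 Omega (T f),
      forall f g, D f -> L2 Omega g -> f =ae g -> D g /\ T f =ae T g,
      D (fun=> 0) &
      forall (z : C) f g, D f -> D g ->
        D (fun x => z * f x + g x) /\
        T (fun x => z * f x + g x) =ae (fun x => z * T f x + T g x)].

Definition linear_operator (L : operator) := linear_operator_on (op_dom L) L.

Definition bounded_operator (T : (X -> C) -> (X -> C)) :=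
  linear_operator_on (L2 Omega) T /\
  exists M : R, forall f, L2 Omega f -> L2norm Omega (T f) <= M * L2norm Omega f.

Definition is_adjoint_value (L : operator) (g h : X -> C) :=
  L2 Omega h /\ forall f, op_dom L f -> L2inner Omega (L f) g = L2inner Omega f h.

Definition adjoint (L : operator) : operator := {|
  op_dom := [set g | L2 Omega g /\ exists h, is_adjoint_value L g h];
  op_fun := fun g => xget (fun=> 0) (is_adjoint_value L g) |}.

Definition multiindex (m : nat) := {ffun 'I_n -> 'I_m.+1}.

Definition mi (m : nat) (alpha : multiindex m) : 'I_n -> nat := fun i => alpha i.

(* The transpose of \sum_(|alpha| <= m) c_alpha \partial^alpha. *)
Definition transpose_diffop (m : nat) (c : multiindex m -> X -> C)
    (phi : X -> C) : X -> C := fun x =>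
  \sum_(alpha : multiindex m | (mi_size (mi alpha) <= m)%N)
    (-1) ^+ mi_size (mi alpha) *
    multi_partial (mi alpha) (fun y => c alpha y * phi y) x.

(* L f = \sum_(|alpha| <= m) c_alpha \partial^alpha f in the sense of
   distributions on Omega; the boundary conditions are encoded in the linear
   space [op_dom L]. *)
Definition differential_operator (m : nat) (L : operator) : Prop :=
  exists c : multiindex m -> X -> C,
    [/\ forall alpha, smooth Omega (c alpha),
        exists alpha x, [/\ mi_size (mi alpha) = m, Omega x & c alpha x <> 0] &
        forall f phi, op_dom L f -> test_function Omega phi ->
          cintegral Omega (fun x => L f x * phi x) =
          cintegral Omega (fun x => f x * transpose_diffop c phi x)].

Definition resolvent_set (L : operator) : set C :=
  [set z | exists B, [/\ bounded_operator B,
    forall g, L2 Omega g ->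
      op_dom L (B g) /\ (fun x => L (B g) x - z * B g x) =ae g &
    forall f, op_dom L f -> B (fun x => L f x - z * f x) =ae f]].

Definition spectrum (L : operator) : set C := ~` resolvent_set L.

Definition Cinfty (L : operator) : set (X -> C) :=
  [set f | L2 Omega f /\ forall j, op_dom L (iter j L f)].

Definition graph_norm (L : operator) (k : nat) (f : X -> C) : R :=
  \big[Num.max/0]_(j < k.+1) L2norm Omega (iter j L f).

Definition Cinfty_complete (L : operator) : Prop :=
  forall f : nat -> X -> C, (forall p, Cinfty L (f p)) ->
  (forall k (e : R), 0 < e -> exists N, forall p q, (N <= p)%N -> (N <= q)%N ->
     graph_norm L k (fun x => f p x - f q x) < e) ->
  exists2 g, Cinfty L g &
    forall k, graph_norm L k (fun x => f p x - g x) @[p --> \oo] --> (0 : R).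

Section families.
Variables (Xi : choiceType) (I : set Xi).
Implicit Types e : Xi -> X -> C.

Definition finite_comb e (s : {fset Xi}) (c : Xi -> C) : X -> C :=
  fun x => \sum_(xi <- s) c xi * e xi x.

Definition riesz_basis e : Prop :=
  [/\ forall xi, I xi -> L2 Omega (e xi),
      forall f, L2 Omega f -> forall eps : R, 0 < eps ->
        exists (s : {fset Xi}) (c : Xi -> C), [set` s] `<=` I /\
          L2norm Omega (fun x => f x - finite_comb e s c x) < eps &
      exists A B : R, [/\ 0 < A, 0 < B &
        forall (s : {fset Xi}) (c : Xi -> C), [set` s] `<=` I ->
          A * (\sum_(xi <- s) cabs (c xi) ^+ 2)
            <= L2norm Omega (finite_comb e s c) ^+ 2
            <= B * (\sum_(xi <- s) cabs (c xi) ^+ 2)]].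

(* The spectrum is {lambda_xi}, its points are isolated, and each is an
   eigenvalue listed as many times as its (finite) multiplicity: the e_xi with
   lambda_xi = z, which are linearly independent when biorthogonal to some
   family, span the eigenspace at z. As the eigenfunctions of a Riesz basis
   diagonalize L, geometric and algebraic multiplicities agree. *)
Definition discrete_spectrum (L : operator) (lambda : Xi -> C) e : Prop :=
  [/\ spectrum L = lambda @` I,
      forall xi, I xi -> exists2 d : R, 0 < d &
        forall eta, I eta -> lambda eta <> lambda xi ->
          d <= cabs (lambda eta - lambda xi),
      forall xi, I xi -> finite_set [set eta | I eta /\ lambda eta = lambda xi] &
      forall f z, op_dom L f -> L f =ae (fun x => z * f x) ->
        exists (s : {fset Xi}) (c : Xi -> C),
          [set` s] `<=` [set eta | I eta /\ lambda eta = z] /\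
          f =ae finite_comb e s c].

Definition biorthonormal (u v : Xi -> X -> C) : Prop :=
  (forall xi, I xi -> L2norm Omega (u xi) = 1) /\
  (forall xi eta, I xi -> I eta ->
     L2inner Omega (u xi) (v eta) = (xi == eta)%:R).

Definition eigenfunctions (L : operator) (lambda : Xi -> C) e : Prop :=
  forall xi, I xi -> op_dom L (e xi) /\ L (e xi) =ae (fun x => lambda xi * e xi x).

(* \sum_(xi in I) t xi = z, with unconditional convergence. *)
Definition has_sum (t : Xi -> C) (z : C) : Prop :=
  forall eps : R, 0 < eps -> exists2 s0 : {fset Xi}, [set` s0] `<=` I &
    forall s : {fset Xi}, [set` s0] `<=` [set` s] -> [set` s] `<=` I ->
      cabs (\sum_(xi <- s) t xi - z) < eps.

Definition fourier_coeff (v : Xi -> X -> C) (f : X -> C) (xi : Xi) : C :=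
  L2inner Omega f (v xi).

(* Op_L(a) f = g, the series converging almost everywhere in Omega. *)
Definition is_Op (u v : Xi -> X -> C) (a : X -> Xi -> C) (f g : X -> C) : Prop :=
  {ae lebesgue_rV R n, forall x, Omega x ->
    has_sum (fun xi => u xi x * a x xi * fourier_coeff v f xi) (g x)}.

End families.

End operators.

(* The Euclidean norm on Z^K. *)
Definition latt_norm (R : realType) (K : nat) (xi : 'rV[int]_K) : R :=
  Num.sqrt (\sum_(i < K) ((xi ord0 i)%:~R ^+ 2)).

(* <xi> = (1 + |lambda_xi|^2)^(1/(2m)), as a function of z = lambda_xi. *)
Definition japanese (R : realType) (m : nat) (z : R[i]) : R :=
  (1 + cabs z ^+ 2) `^ ((2 * m)%:R^-1).

Definition WZ (R : realType) (n m K : nat) (Omega : set 'rV[R]_n)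
    (I : set 'rV[int]_K) (lambda : 'rV[int]_K -> R[i])
    (u v : 'rV[int]_K -> 'rV[R]_n -> R[i]) : Prop :=
  (forall xi x, I xi -> closure Omega x -> u xi x <> 0 /\ v xi x <> 0) /\
  exists c N r : R, [/\ 0 < c, 0 <= N &
    forall xi, I xi -> r <= latt_norm R xi ->
      c * japanese m (lambda xi) `^ (- N)
        <= inf [set cabs (u xi x) | x in Omega] /\
      c * japanese m (lambda xi) `^ (- N)
        <= inf [set cabs (v xi x) | x in Omega]].

(* Main.v *)
Require Import Defs.
From HB Require Import structures.
From mathcomp Require Import all_boot all_order all_algebra.
From mathcomp Require Import finmap.
From mathcomp Require Import complex.
From mathcomp Require Import ring lra.
From mathcomp Require Import all_classical all_reals all_analysis.
From mathcomp Require Import measurable_realfun.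

Set Implicit Arguments.
Unset Strict Implicit.
Unset Printing Implicit Defensive.

Import Order.TTheory GRing.Theory Num.Theory.
Import numFieldNormedType.Exports.

Local Open Scope classical_set_scope.
Local Open Scope ring_scope.

(** Why the theorem is true. Write [Op(a) f] at the point [x] as the sum over
    [xi] of [u xi x * a x xi * c xi], where [c] is the family of coefficients of
    [f]. Bessel's inequality for the Riesz basis [v] bounds the square sum of
    [c] by the square of the norm of [f], so everything rests on one estimate:
    for finitely many frequencies, the square of the [L^2] norm of that sum is
    at most a constant times the square sum of [c] ([bounded_symbol_form]). The
    constant must not depend on the set of frequencies.

    If [a] does not depend on [x], the estimate is the upper Riesz bound for [u].
    The usual way to reach variable symbols is to freeze [x] in the symbol and
    to apply the Sobolev embedding of [H^k] into the bounded functions to the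
    frozen variable. The proof below replaces this embedding by approximation at
    dyadic scales. At scale [j] the domain is covered by about [2 ^ (j n)] cubes
    of side about [2 ^ (- j)], all contained in the open set on which the symbol
    is of class [C^k], and in each cube the symbol is replaced by its Lagrange
    interpolation polynomial with [k] nodes in each variable. The pure
    derivatives of order [k] are bounded uniformly in [xi], hence the error of
    this approximation is of order [2 ^ (- j k)] ([interp_error]).

    In a cube of scale [j + 1], the difference between the approximations at
    scales [j + 1] and [j] is again an interpolation polynomial: it is a fixed
    finite combination of products of a bounded function of [x] and a function of
    [xi] of size [2 ^ (- j k)] ([levelBE], [symbol_bound_interp]). Each such
    product is estimated by the Riesz bound for [u]. The contributions of
    different cubes have disjoint supports, so their square integrals add up,
    and the operator of the difference has norm at most a constant times
    [2 ^ (j n / 2 - j k)] ([symbol_bound_fine]). This is a geometric series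
    exactly because [k > n / 2], and the sum over the scales bounds the operator
    with symbol [a] ([symbol_bound_multiscale]).

    By this estimate and Bessel's inequality the partial sums of the series of
    [Op(a) f] converge in [L^2] for every [f] in [L^2] ([mean_square_complete]),
    and their limit is the extension. If [f] is a test function, then the
    coefficients of [L ^ j f] are [lambda xi ^ j * c xi], so [c] decays faster
    than any power of the bracket of [xi] and is summable
    ([fourier_coeff_decay]); as the [u xi] are normalized, the series converges
    absolutely almost everywhere ([ae_summable]), and its sum is the [L^2]
    limit. *)

(** * Taylor and Lagrange polynomials in one variable *)

Section Interpolation1.
Variable R : realType.

Lemma poly_antideriv (q : {poly R}) :
  exists2 p : {poly R}, p^`() = q & (size p <= (size q).+1)%N.
Proof.
exists (\poly_(i < (size q).+1) (q`_i.-1 *+ (i != 0%N) / i%:R)); last exact: size_poly.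
apply/polyP => i; rewrite coef_deriv coef_poly ltnS.
case: ltnP => [iq|qi] /=.
  by rewrite mulr1n -[LHS]mulr_natr divfK // pnatr_eq0.
by rewrite mul0rn nth_default.
Qed.

(** By induction on [k]: the polynomial for [psi 0] is the antiderivative of the
    one for [psi 1] that is exact at [o], and the mean value theorem bounds the
    accumulated error. The classical remainder also has a factorial, which this
    argument loses. *)
Lemma taylor_poly (k : nat) (psi : nat -> R -> R) (o h M : R) :
  0 <= h ->
  (forall r t, (r < k)%N -> o <= t <= o + h ->
    is_derive t 1 (psi r) (psi r.+1 t)) ->
  (forall t, o <= t <= o + h -> `|psi k t| <= M) ->
  exists2 q : {poly R}, (size q <= k)%N &
    forall t, o <= t <= o + h -> `|psi 0%N t - q.[t]| <= M * h ^+ k.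
Proof.
move=> h0; elim: k psi => [|k IH] psi dpsi psiM.
  exists 0; first by rewrite size_poly0.
  by move=> t ot; rewrite horner0 subr0 expr0 mulr1 psiM.
have [||q' sq' Hq'] := IH (fun r => psi r.+1).
- by move=> r t rk; apply: dpsi.
- by [].
have [p dp sp] := poly_antideriv q'.
exists (p + (psi 0%N o - p.[o])%:P).
  rewrite (leq_trans (size_polyD _ _)) // geq_max (leq_trans sp) //=.
  by rewrite (leq_trans (size_polyC_leq1 _)).
move=> t /andP[ot th].
set e := fun s => psi 0%N s - p.[s].
have de s : o <= s <= o + h -> is_derive s 1 e (psi 1%N s - q'.[s]).
  move=> os; rewrite /e -dp; apply: is_deriveB; first exact: dpsi.
have ce : {within `[o, t], continuous e}.
  apply: derivable_within_continuous => s; rewrite in_itv /= => /andP[os st].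
  by have [] := de s; rewrite ?os ?(le_trans st).
have [|s] := @MVT_segment _ e (fun s => psi 1%N s - q'.[s]) o t ot _ ce.
  move=> s; rewrite in_itv /= => /andP[os st]; apply: de.
  by rewrite (ltW os) (le_trans (ltW st)).
rewrite in_itv /= => /andP[os st] et.
have -> : psi 0%N t - (p + (psi 0%N o - p.[o])%:P).[t] = e t - e o.
  by rewrite hornerD hornerC /e; ring.
rewrite et normrM exprSr mulrA ler_pM //.
  by apply: Hq'; rewrite os (le_trans st).
by rewrite ger0_norm ?subr_ge0 // lerBlDl.
Qed.

Variable k : nat.
Hypothesis k_gt0 : (0 < k)%N.

Definition lagr (nu : 'I_k) : {poly R} :=
  tnth (lagrange k (fun j : nat => j%:R : R)) nu.

Let natr_inj : injective (fun j : nat => j%:R : R).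
Proof. by move=> i j /eqP; rewrite eqr_nat => /eqP. Qed.

Lemma size_lagr nu : (size (lagr nu) <= k)%N.
Proof. by rewrite /lagr (@size_lagrange_ _ _ _ k_gt0 natr_inj). Qed.

(** The affine change of variable to the reference nodes [0, ..., k - 1]
    preserves the degree, so this is the exactness of Lagrange interpolation. *)
Lemma lagr_reproduce (q : {poly R}) (o e t : R) : (size q <= k)%N -> e != 0 ->
  \sum_(nu < k) (lagr nu).[(t - o) / e] * q.[o + e * nu%:R] = q.[t].
Proof.
move=> sq e0; pose l : {poly R} := e *: 'X + o%:P; pose p := q \Po l.
have sl : (size l <= 2)%N.
  rewrite (leq_trans (size_polyD _ _)) // geq_max.
  by rewrite (leq_trans (size_scale_leq _ _)) ?size_polyX // (leq_trans (size_polyC_leq1 _)).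
have sp : (size p <= k)%N.
  case: (size q) sq (size_comp_poly_leq q l) => [|s] sk.
    by rewrite mul0n; move/leq_trans; apply.
  move/leq_trans; apply; rewrite (leq_ltn_trans _ sk) //= -[leqRHS]muln1 leq_mul2l.
  by case: (size _) sl => [|[|[|]]] //; rewrite ?orbT.
have := lagrange_gen k_gt0 natr_inj sp.
move=> /(congr1 (fun p : {poly R} => p.[(t - o) / e])); rewrite horner_sum.
have El x : l.[x] = o + e * x by rewrite hornerD hornerZ hornerX hornerC addrC.
rewrite /p horner_comp El (mulrC e) divfK // addrC subrK => ->.
by apply: eq_bigr => nu _; rewrite hornerM hornerC horner_comp El mulrC.
Qed.

Lemma poly_bounded (p : {poly R}) (K : R) :
  exists2 B : R, 0 <= B & forall s, 0 <= s <= K -> `|p.[s]| <= B.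
Proof.
case: (leP 0 K) => K0; last first.
  by exists 0 => // s /andP[s0 /(le_trans s0)]; rewrite leNgt K0.
exists (\sum_(i < size p) `|p`_i| * K ^+ i).
  by apply: sumr_ge0 => i _; rewrite mulr_ge0 ?exprn_ge0.
move=> s /andP[s0 sK]; rewrite horner_coef (le_trans (ler_norm_sum _ _ _)) //.
apply: ler_sum => i _; rewrite normrM ler_wpM2l // ger0_norm ?exprn_ge0 //.
by rewrite lerXn2r ?nnegrE.
Qed.

Lemma lagr_bounded : exists2 B : R, 1 <= B &
  forall nu s, 0 <= s <= k%:R -> `|(lagr nu).[s]| <= B.
Proof.
have /choice[B HB] : forall nu, exists B, 0 <= B /\
    forall s, 0 <= s <= k%:R -> `|(lagr nu).[s]| <= B.
  by move=> nu; have [B ? ?] := poly_bounded (lagr nu) k%:R; exists B.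
exists (1 + \sum_nu B nu).
  by rewrite lerDl sumr_ge0 // => nu _; have [] := HB nu.
move=> nu s sk; have [B0 /(_ _ sk)/le_trans] := HB nu; apply.
rewrite (bigD1 nu) //= addrCA lerDl addr_ge0 // sumr_ge0 // => j _.
by have [] := HB j.
Qed.

End Interpolation1.

(** * Interpolation in several variables *)

Section TensorInterpolation.
Variables (R : realType) (n k : nat).
Hypothesis k_gt0 : (0 < k)%N.
Local Notation X := 'rV[R]_n.

Definition subst (x : X) (i : 'I_n) (t : R) : X :=
  \row_j (if j == i then t else x ord0 j).

Lemma subst_id x i : subst x i (x ord0 i) = x.
Proof. by apply/rowP => j; rewrite mxE; case: eqP => // ->. Qed.

Lemma subst_eq x i t : subst x i t ord0 i = t.
Proof. by rewrite mxE eqxx. Qed.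

Lemma subst_subst x i s t : subst (subst x i s) i t = subst x i t.
Proof. by apply/rowP => j; rewrite !mxE; case: eqP. Qed.

Lemma substC x i j s t : i != j ->
  subst (subst x i s) j t = subst (subst x j t) i s.
Proof.
move=> ij; apply/rowP => l; rewrite !mxE.
by case: (l =P j) => // ->; rewrite eq_sym (negbTE ij).
Qed.

Section Cube.
Variables (o : 'I_n -> R) (e : R).

(** The length [e] is the spacing of the interpolation nodes [o i + e * nu],
    [nu < k], so the side of the cube is [e * k]. *)
Definition cube : set X := [set x | forall i, o i <= x ord0 i <= o i + e * k%:R].

Definition interp1 (i : 'I_n) (G : X -> R) : X -> R := fun x =>
  \sum_(nu < k) (lagr R nu).[(x ord0 i - o i) / e] *
                G (subst x i (o i + e * nu%:R)).

Definition interp (l : seq 'I_n) (G : X -> R) : X -> R := foldr interp1 G l.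

Lemma interpB l G H x : interp l (fun y => G y - H y) x = interp l G x - interp l H x.
Proof.
elim: l x => //= i l IH x; rewrite /interp1 -sumrB; apply: eq_bigr => nu _.
by rewrite -!/(interp _ _) IH mulrBr.
Qed.

Definition poly_in (i : 'I_n) (G : X -> R) : Prop :=
  forall x, exists2 q : {poly R}, (size q <= k)%N &
    forall t, G (subst x i t) = q.[t].

Lemma poly_in_interp1_same i G : poly_in i (interp1 i G).
Proof.
move=> x; pose m : {poly R} := e^-1 *: 'X - (e^-1 * o i)%:P.
have sm : (size m <= 2)%N.
  rewrite (leq_trans (size_polyD _ _)) // geq_max size_polyN.
  by rewrite (leq_trans (size_scale_leq _ _)) ?size_polyX // (leq_trans (size_polyC_leq1 _)).
exists (\sum_(nu < k) G (subst x i (o i + e * nu%:R)) *: (lagr R nu \Po m)).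
  rewrite (leq_trans (size_sum _ _ _)) //; apply/bigmax_leqP => nu _.
  rewrite (leq_trans (size_scale_leq _ _)) //.
  have := size_lagr R k_gt0 nu; have := size_comp_poly_leq (lagr R nu) m.
  case: (size (lagr R nu)) => [|s]; first by rewrite mul0n => /leq_trans + _; apply.
  move=> /leq_trans + sk; apply; rewrite (leq_ltn_trans _ sk) //= -[leqRHS]muln1 leq_mul2l.
  by case: (size m) sm => [|[|[|]]] //; rewrite ?orbT.
move=> t; rewrite horner_sum; apply: eq_bigr => nu _.
rewrite subst_eq subst_subst hornerZ horner_comp mulrC; congr (_ * (lagr R nu).[_]).
by rewrite hornerD hornerN hornerZ hornerX hornerC -mulrBr mulrC.
Qed.

Lemma poly_in_interp1 i j G : poly_in i G -> poly_in i (interp1 j G).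
Proof.
case: (eqVneq j i) => [-> _|ji pG x]; first exact: poly_in_interp1_same.
have /choice[q Hq] : forall nu : 'I_k, exists q : {poly R}, (size q <= k)%N /\
    forall t, G (subst (subst x j (o j + e * nu%:R)) i t) = q.[t].
  by move=> nu; have [q ? ?] := pG (subst x j (o j + e * nu%:R)); exists q.
exists (\sum_(nu < k) (lagr R nu).[(x ord0 j - o j) / e] *: q nu).
  rewrite (leq_trans (size_sum _ _ _)) //; apply/bigmax_leqP => nu _.
  by rewrite (leq_trans (size_scale_leq _ _)) //; have [] := Hq nu.
move=> t; rewrite horner_sum; apply: eq_bigr => nu _.
rewrite hornerZ; have [_ <-] := Hq nu.
by rewrite substC 1?eq_sym // [in X in _.[X]]mxE (negbTE ji).
Qed.

Lemma poly_in_interp i l G : i \in l -> poly_in i (interp l G).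
Proof.
elim: l => //= j l IH; rewrite inE; case: (eqVneq i j) => [-> _|_ /= il].
  exact: poly_in_interp1_same.
exact/poly_in_interp1/IH.
Qed.

(** A function that is a polynomial of degree less than [k] in each variable is
    left fixed by the interpolation in each single variable. *)
Lemma interp_reproduce l G x : e != 0 -> (forall i, poly_in i G) -> interp l G x = G x.
Proof.
move=> e0 pG; elim: l x => //= i l IH x.
have [q sq Hq] := pG i x.
rewrite /interp1 -[in RHS](subst_id x i) Hq -(lagr_reproduce k_gt0 (o i) _ sq e0).
by apply: eq_bigr => nu _; rewrite -/(interp l G) IH Hq.
Qed.

Variable B : R.
Hypothesis lagr_le : forall nu (t : R), 0 <= t <= k%:R -> `|(@lagr R k nu).[t]| <= B.
Hypothesis e_gt0 : 0 < e.

Lemma node_in_cube (nu : 'I_k) i : o i <= o i + e * nu%:R <= o i + e * k%:R.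
Proof.
rewrite lerDl mulr_ge0 ?(ltW e_gt0) //= lerD2l ler_pM2l // ler_nat.
by rewrite ltnW.
Qed.

Lemma subst_cube x i t : cube x -> o i <= t <= o i + e * k%:R -> cube (subst x i t).
Proof. by move=> Qx ot j; rewrite mxE; case: eqP => // ->. Qed.

Lemma cube_param x i : cube x -> 0 <= (x ord0 i - o i) / e <= k%:R.
Proof.
move=> /(_ i) /andP[ox xo].
by rewrite divr_ge0 ?subr_ge0 ?(ltW e_gt0) //= ler_pdivrMr // mulrC lerBlDl.
Qed.

Lemma lagr_sum_le (c : 'I_k -> R) M s : 0 <= s <= k%:R ->
  (forall nu, `|c nu| <= M) ->
  `|\sum_(nu < k) (lagr R nu).[s] * c nu| <= k%:R * B * M.
Proof.
move=> s0 cM; rewrite (le_trans (ler_norm_sum _ _ _)) //.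
rewrite -mulrA mulr_natl -[leRHS](_ : \sum_(nu < k) B * M = _); last first.
  by rewrite sumr_const card_ord.
apply: ler_sum => nu _; rewrite normrM ler_pM //; exact: lagr_le.
Qed.

Lemma interp1_le i G M : (forall x, cube x -> `|G x| <= M) ->
  forall x, cube x -> `|interp1 i G x| <= k%:R * B * M.
Proof.
move=> GM x Qx; apply: lagr_sum_le => [|nu]; first exact: cube_param.
by apply/GM/subst_cube => //; exact: node_in_cube.
Qed.

Variables (G : X -> R) (E : R).
Hypothesis G_approx : forall x i, cube x -> exists2 q : {poly R}, (size q <= k)%N &
  forall t, o i <= t <= o i + e * k%:R -> `|G (subst x i t) - q.[t]| <= E.

(** Both [G] and its interpolation are compared with the polynomial that
    approximates [G] on the line through [x]. *)
Lemma interp1_error i x : cube x -> `|interp1 i G x - G x| <= (1 + k%:R * B) * E.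
Proof.
move=> Qx; have [q sq Hq] := G_approx i Qx.
have -> : interp1 i G x - G x =
    \sum_(nu < k) (lagr R nu).[(x ord0 i - o i) / e] *
      (G (subst x i (o i + e * nu%:R)) - q.[o i + e * nu%:R])
    - (G x - q.[x ord0 i]).
  rewrite -(lagr_reproduce k_gt0 (o i) (x ord0 i) sq (lt0r_neq0 e_gt0)).
  under eq_bigr do rewrite mulrBr.
  by rewrite sumrB /interp1; ring.
rewrite [leRHS]mulrDl mul1r (le_trans (ler_normB _ _)) // addrC lerD //.
  by have := Hq (x ord0 i) (Qx i); rewrite subst_id.
apply: lagr_sum_le => [|nu]; first exact: cube_param.
by apply: Hq; exact: node_in_cube.
Qed.

(** The error constant after interpolating [r] variables: each interpolation
    amplifies the previous error and adds its own. *)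
Definition interp_const (r : nat) : R :=
  iter r (fun A => k%:R * B * A + (1 + k%:R * B)) 0.

(** In [J (I G) - G = J (I G - G) + (J G - G)], where [J] interpolates one more
    variable than [I], the first term is small by induction, since [J] multiplies
    bounds on the cube by at most [k * B], and the second one is the error in
    one variable. *)
Lemma interp_error l x : cube x ->
  `|interp l G x - G x| <= interp_const (size l) * E.
Proof.
elim: l x => [|i l IH] x Qx /=; first by rewrite subrr normr0 mul0r.
have -> : interp1 i (interp l G) x - G x =
    interp1 i (fun y => interp l G y - G y) x + (interp1 i G x - G x).
  rewrite addrA; congr (_ - _); rewrite /interp1 -big_split; apply: eq_bigr => nu _ /=.
  by rewrite mulrBr subrK.
rewrite mulrDl (le_trans (ler_normD _ _)) // lerD //; last exact: interp1_error.
by rewrite -mulrA; exact: interp1_le.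
Qed.

End Cube.
End TensorInterpolation.

(** * Restrictions of C^k functions to lines *)

Section SmoothOnLines.
Variables (R : realType) (n : nat).
Local Notation X := 'rV[R]_n.

Definition partial (i : 'I_n) (f : X -> R) : X -> R :=
  fun x => 'D_(basis_vec R i) f x.

Lemma is_derive_subst (f : X -> R) x i t :
  derivable f (subst x i t) (basis_vec R i) ->
  is_derive t 1 (fun s => f (subst x i s)) (partial i f (subst x i t)).
Proof.
have E : (fun h : R => h^-1 *: (((fun s => f (subst x i s)) \o shift t) (h *: (1 : R)) -
                         f (subst x i t))) =
         (fun h : R => h^-1 *: ((f \o shift (subst x i t)) (h *: basis_vec R i) -
                         f (subst x i t))).
  apply/funext => h /=; congr (_ *: (f _ - _)).
  apply/rowP => j; rewrite !mxE eqxx /=; case: (j =P i) => _.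
    by rewrite mulr1 [h%:A]mulr1.
  by rewrite mulr0 add0r.
by move=> df; split; rewrite /derivable /derive /partial ?E.
Qed.

Lemma real_Ck_derivable k (U : set X) f i r x : real_Ck k U f -> (r < k)%N -> U x ->
  derivable (iter r (partial i) f) x (basis_vec R i).
Proof.
elim: k r f => // k IH [|r] f [_ /(_ i)[df Cf]] rk Ux; first exact: df.
by rewrite iterSr; exact: IH.
Qed.

Lemma real_Ck_line_poly k (U : set X) f (o : 'I_n -> R) (e M : R) :
  0 <= e -> real_Ck k U f -> cube k o e `<=` U ->
  (forall i x, U x -> `|iter k (partial i) f x| <= M) ->
  forall x i, cube k o e x -> exists2 q : {poly R}, (size q <= k)%N &
    forall t, o i <= t <= o i + e * k%:R ->
      `|f (subst x i t) - q.[t]| <= M * (e * k%:R) ^+ k.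
Proof.
move=> e0 Cf QU fM x i Qx.
apply: (@taylor_poly R k (fun r t => iter r (partial i) f (subst x i t))).
- by rewrite mulr_ge0.
- move=> r t rk ot; apply: is_derive_subst.
  by apply: (real_Ck_derivable Cf rk); apply/QU/subst_cube.
- by move=> t ot; apply/fM/QU/subst_cube.
Qed.

(** The pure derivatives of order [k] are those that govern interpolation in one
    variable at a time. *)
Lemma multi_partial_pure (i : 'I_n) k (f : X -> R[i]) :
  multi_partial (fun j => if j == i then k else 0%N) f = iter k (cpartial i) f.
Proof.
rewrite /multi_partial.
have : i \in enum 'I_n by rewrite mem_enum.
elim: (enum 'I_n) (enum_uniq 'I_n) => //= j l IH /andP[jl ul].
rewrite inE eq_sym; case: (j =P i) => [ji _|/eqP /negbTE ji /= il]; last first.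
  exact: IH.
transitivity (iter k (cpartial i) (foldr (fun j g => iter
    (if j == i then k else 0%N) (cpartial j) g) f l)); first by rewrite ji.
congr (iter _ _ _); move: jl; rewrite ji.
elim: l {IH ul} => //= a l IH; rewrite inE negb_or eq_sym.
by move=> /andP[/negbTE -> /IH].
Qed.

Lemma mi_size_pure (i : 'I_n) k : mi_size (fun j => if j == i then k else 0%N) = k.
Proof. by rewrite /mi_size -big_mkcond big_pred1_eq. Qed.

Lemma Re_iter_cpartial (i : 'I_n) k (f : X -> R[i]) :
  @complex.Re R \o iter k (cpartial i) f = iter k (partial i) (@complex.Re R \o f).
Proof. by elim: k => //= k <-. Qed.

Lemma Im_iter_cpartial (i : 'I_n) k (f : X -> R[i]) :
  @complex.Im R \o iter k (cpartial i) f = iter k (partial i) (@complex.Im R \o f).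
Proof. by elim: k => //= k <-. Qed.

End SmoothOnLines.

Section ComplexModulus.
Variable R : realType.
Implicit Types z w : R[i].

Lemma cabs_ge0 z : 0 <= cabs z.
Proof. by case: z => a b; exact: sqrtr_ge0. Qed.

Lemma cabs0 : cabs (0 : R[i]) = 0.
Proof. exact: ComplexField.Normc.normc0. Qed.

Lemma cabsM z w : cabs (z * w) = cabs z * cabs w.
Proof. exact: ComplexField.Normc.normcM. Qed.

Lemma cabsX z p : cabs (z ^+ p) = cabs z ^+ p.
Proof.
elim: p => [|p IH]; last by rewrite !exprS cabsM IH.
by rewrite !expr0 /cabs ComplexField.Normc.normc1.
Qed.

Lemma cabs2 z : cabs z ^+ 2 = complex.Re z ^+ 2 + complex.Im z ^+ 2.
Proof. by case: z => a b /=; rewrite sqr_sqrtr // addr_ge0 ?sqr_ge0. Qed.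

Lemma cabs_real (t : R) : cabs (t%:C)%C = `|t|.
Proof. by rewrite /cabs /= expr0n addr0 sqrtr_sqr. Qed.

Lemma cabsN z : cabs (- z) = cabs z.
Proof. by case: z => a b; rewrite /cabs /= !sqrrN. Qed.

Lemma cabsJ z : cabs (z^*)%C = cabs z.
Proof. by case: z => a b; rewrite /cabs /= sqrrN. Qed.

Lemma cabsD_le z w : cabs (z + w) <= cabs z + cabs w.
Proof. exact: le_normcD. Qed.

Lemma cabsB_le z w : cabs (z - w) <= cabs z + cabs w.
Proof. by rewrite -(cabsN w) cabsD_le. Qed.

Lemma cabs_eq0 z : cabs z = 0 -> z = 0.
Proof. exact: ComplexField.Normc.eq0_normc. Qed.

Lemma cabs_sum_le (J : Type) (s : seq J) (P : pred J) (F : J -> R[i]) :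
  cabs (\sum_(j <- s | P j) F j) <= \sum_(j <- s | P j) cabs (F j).
Proof.
elim/big_rec2: _ => [|j x y _ le]; first by rewrite cabs0.
by rewrite (le_trans (cabsD_le _ _)) // lerD2l.
Qed.

Lemma Re_le_cabs z : `|complex.Re z| <= cabs z.
Proof.
by rewrite -ler_sqr ?nnegrE ?cabs_ge0 // real_normK ?num_real // cabs2 lerDl sqr_ge0.
Qed.

Lemma Im_le_cabs z : `|complex.Im z| <= cabs z.
Proof.
by rewrite -ler_sqr ?nnegrE ?cabs_ge0 // real_normK ?num_real // cabs2 lerDr sqr_ge0.
Qed.

(** [cabs] splits the square of a sum with an arbitrary weight; optimizing the
    weight turns it into a triangle inequality for quadratic means. *)
Lemma cabs_weighted_sqr z w (t : R) : 0 < t ->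
  cabs (z + w) ^+ 2 <= (1 + t) * cabs z ^+ 2 + (1 + t^-1) * cabs w ^+ 2.
Proof.
move=> t0; apply: (@le_trans _ _ ((cabs z + cabs w) ^+ 2)).
  by rewrite ler_sqr ?nnegrE ?addr_ge0 ?cabs_ge0 // cabsD_le.
have t1 := mulfV (lt0r_neq0 t0).
rewrite -subr_ge0 [leRHS](_ : _ = t * (cabs z - t^-1 * cabs w) ^+ 2).
  by rewrite mulr_ge0 ?sqr_ge0 ?ltW.
by field; rewrite lt0r_neq0.
Qed.

Lemma cabs_sum_sqr (k : nat) (F : 'I_k -> R[i]) :
  cabs (\sum_i F i) ^+ 2 <= k%:R * \sum_i cabs (F i) ^+ 2.
Proof.
elim: k F => [|k IH] F; first by rewrite !big_ord0 cabs0 expr0n mulr0.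
case: (posnP k) => [k0|k0].
  by move: F; rewrite k0 => F; rewrite !big_ord_recl !big_ord0 !addr0 mul1r.
rewrite !big_ord_recl; have k0' : 0 < k%:R :> R by rewrite ltr0n.
apply: le_trans (cabs_weighted_sqr _ _ k0') _.
rewrite mulrDr -natr1 addrC [leRHS]addrC [1 + k%:R]addrC lerD2r.
apply: le_trans (_ : (1 + k%:R^-1) * (k%:R * \sum_(i < k) cabs (F (lift ord0 i)) ^+ 2) <= _).
  by rewrite ler_wpM2l ?IH // addr_ge0 ?invr_ge0.
by rewrite mulrA mulrDl mulVf ?lt0r_neq0 // mul1r.
Qed.

End ComplexModulus.

(** * Measurability and square integrals of complex functions *)

Section ComplexMeasurable.
Context d (T : measurableType d) (R : realType).
Implicit Types (D : set T) (f g : T -> R[i]).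

Definition cmeasurable D f : Prop :=
  measurable_fun D (@complex.Re R \o f) /\ measurable_fun D (@complex.Im R \o f).

Lemma cmeasurable_cst D (z : R[i]) : cmeasurable D (fun=> z).
Proof. by split; exact: measurable_cst. Qed.

Lemma cmeasurable_real D (w : T -> R) :
  measurable_fun D w -> cmeasurable D (fun x => (w x)%:C%C).
Proof. by move=> mw; split => //=; exact: measurable_cst. Qed.

Lemma cmeasurableD D f g : cmeasurable D f -> cmeasurable D g ->
  cmeasurable D (fun x => f x + g x).
Proof.
move=> [rf jf] [rg jg]; split.
  rewrite (_ : _ \o _ = fun x => complex.Re (f x) + complex.Re (g x)).
    exact: measurable_funD.
  by apply/funext => x /=; case: (f x) (g x) => ? ? [].
rewrite (_ : _ \o _ = fun x => complex.Im (f x) + complex.Im (g x)).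
  exact: measurable_funD.
by apply/funext => x /=; case: (f x) (g x) => ? ? [].
Qed.

Lemma cmeasurableM D f g : cmeasurable D f -> cmeasurable D g ->
  cmeasurable D (fun x => f x * g x).
Proof.
move=> [rf jf] [rg jg]; split.
  rewrite (_ : _ \o _ = fun x => complex.Re (f x) * complex.Re (g x) -
                                 complex.Im (f x) * complex.Im (g x)).
    by apply: measurable_funB; exact: measurable_funM.
  by apply/funext => x /=; case: (f x) (g x) => ? ? [].
rewrite (_ : _ \o _ = fun x => complex.Re (f x) * complex.Im (g x) +
                               complex.Im (f x) * complex.Re (g x)).
  by apply: measurable_funD; exact: measurable_funM.
by apply/funext => x /=; case: (f x) (g x) => ? ? [].
Qed.

Lemma cmeasurableZ D z f : cmeasurable D f -> cmeasurable D (fun x => z * f x).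
Proof. by move=> mf; apply: cmeasurableM => //; exact: cmeasurable_cst. Qed.

Lemma cmeasurableB D f g : cmeasurable D f -> cmeasurable D g ->
  cmeasurable D (fun x => f x - g x).
Proof.
move=> mf mg; have := cmeasurableD mf (cmeasurableZ (-1) mg).
by congr (cmeasurable D _); apply/funext => x; rewrite mulN1r.
Qed.

Lemma cmeasurableJ D f : cmeasurable D f -> cmeasurable D (fun x => (f x)^*%C).
Proof.
move=> [rf jf]; split.
  by rewrite (_ : _ \o _ = @complex.Re R \o f) //; apply/funext => x /=; case: (f x).
rewrite (_ : _ \o _ = \- (@complex.Im R \o f)); first exact: measurable_funN.
by apply/funext => x /=; case: (f x).
Qed.

Lemma cmeasurable_sum D (J : eqType) (s : seq J) (F : J -> T -> R[i]) :
  (forall j, j \in s -> cmeasurable D (F j)) ->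
  cmeasurable D (fun x => \sum_(j <- s) F j x).
Proof.
elim: s => [|j s IH] mF.
  by under eq_fun do rewrite big_nil; exact: cmeasurable_cst.
under eq_fun do rewrite big_cons; apply: cmeasurableD.
  by apply: mF; rewrite mem_head.
by apply: IH => i si; apply: mF; rewrite inE si orbT.
Qed.

Lemma cmeasurableS D E f : measurable E -> D `<=` E -> cmeasurable E f -> cmeasurable D f.
Proof. by move=> mE DE [rf jf]; split; exact: measurable_funS rf || exact: measurable_funS jf. Qed.

Lemma eq_cmeasurable D f g : {in D, f =1 g} -> cmeasurable D f -> cmeasurable D g.
Proof.
move=> fg [rf jf]; split; [move: rf|move: jf]; apply: eq_measurable_fun => x Dx /=;
by rewrite fg.
Qed.

Lemma measurable_cabs2 D f : cmeasurable D f ->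
  measurable_fun D (fun x => (cabs (f x) ^+ 2)%:E).
Proof.
move=> [rf jf]; apply/measurable_EFinP.
under eq_fun do rewrite cabs2.
by apply: measurable_funD; exact: measurable_funX.
Qed.

End ComplexMeasurable.

Section SquareIntegral.
Context d (T : measurableType d) (R : realType) (mu : {measure set T -> \bar R}).
Implicit Types (D : set T) (f g : T -> R[i]).

Definition sqint D f : \bar R := (\int[mu]_(x in D) (cabs (f x) ^+ 2)%:E)%E.

Lemma sqint_ge0 D f : (0 <= sqint D f)%E.
Proof. by apply: integral_ge0 => x _; rewrite lee_fin sqr_ge0. Qed.

Lemma eq_sqint D f g : {in D, f =1 g} -> sqint D f = sqint D g.
Proof. by move=> fg; apply: eq_integral => x Dx; rewrite fg. Qed.

Lemma sqint_mul D W f g : measurable D -> cmeasurable D f -> cmeasurable D g -> 0 <= W ->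
  (forall x, D x -> cabs (f x) <= W * cabs (g x)) ->
  (sqint D f <= (W ^+ 2)%:E * sqint D g)%E.
Proof.
move=> mD mf mg W0 fg; rewrite /sqint -ge0_integralZl_EFin ?sqr_ge0 //; last 2 first.
- by move=> x _; rewrite lee_fin sqr_ge0.
- exact: measurable_cabs2.
apply: ge0_le_integral => //; try exact: measurable_cabs2.
- by move=> x _; rewrite lee_fin sqr_ge0.
- by apply: measurable_funeM; exact: measurable_cabs2.
move=> x Dx; rewrite -EFinM lee_fin -exprMn ler_sqr ?nnegrE ?mulr_ge0 ?cabs_ge0 //.
exact: fg.
Qed.

Lemma sqint_weighted D (t : R) f g : measurable D -> cmeasurable D f -> cmeasurable D g ->
  0 < t ->
  (sqint D (fun x => (f x + g x)%R) <=
    (1 + t)%:E * sqint D f + (1 + t^-1)%:E * sqint D g)%E.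
Proof.
move=> mD mf mg t0.
have t1 : 0 <= 1 + t by rewrite addr_ge0 // ltW.
have t2 : 0 <= 1 + t^-1 by rewrite addr_ge0 // invr_ge0 ltW.
rewrite /sqint -!ge0_integralZl_EFin //; try exact: measurable_cabs2;
  try by move=> x _; rewrite lee_fin sqr_ge0.
rewrite -ge0_integralD //; try (by apply: measurable_funeM; exact: measurable_cabs2);
  try by move=> x _; rewrite -EFinM lee_fin mulr_ge0 ?sqr_ge0.
apply: ge0_le_integral => //.
- by move=> x _; rewrite lee_fin sqr_ge0.
- by apply: measurable_cabs2; exact: cmeasurableD.
- by apply: emeasurable_funD; apply: measurable_funeM; exact: measurable_cabs2.
by move=> x _; rewrite -!EFinM -EFinD lee_fin; exact: cabs_weighted_sqr.
Qed.

Lemma sqintD D f g : measurable D -> cmeasurable D f -> cmeasurable D g ->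
  (sqint D (fun x => (f x + g x)%R) <= 2%:E * (sqint D f + sqint D g))%E.
Proof.
move=> mD mf mg; apply: le_trans (sqint_weighted mD mf mg ltr01) _.
by rewrite invr1 (_ : (1 + 1)%R = 2%R :> R) -?ge0_muleDr ?sqint_ge0.
Qed.

Lemma sqintN D f : sqint D (fun x => - f x) = sqint D f.
Proof. by apply: eq_integral => x _; rewrite cabsN. Qed.

Lemma sqint_distC D f g : sqint D (fun x => f x - g x) = sqint D (fun x => g x - f x).
Proof. by rewrite -sqintN; apply: eq_integral => x _; rewrite opprB. Qed.

Lemma sqint_sum D (k : nat) (F : 'I_k -> T -> R[i]) : measurable D ->
  (forall j, cmeasurable D (F j)) ->
  (sqint D (fun x => (\sum_j F j x)%R) <= k%:R%:E * \sum_j sqint D (F j))%E.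
Proof.
move=> mD mF; rewrite /sqint.
rewrite -[X in (_ <= _ * X)%E]ge0_integral_sum //; last 2 first.
- by move=> j; exact: measurable_cabs2.
- by move=> j x _; rewrite lee_fin sqr_ge0.
rewrite -ge0_integralZl_EFin //; last 2 first.
- by move=> x _; apply: sume_ge0 => j _; rewrite lee_fin sqr_ge0.
- by apply: emeasurable_sum => j; exact: measurable_cabs2.
apply: ge0_le_integral => //.
- by move=> x _; rewrite lee_fin sqr_ge0.
- by apply: measurable_cabs2; exact: cmeasurable_sum.
- by apply: measurable_funeM; apply: emeasurable_sum => j; exact: measurable_cabs2.
by move=> x _; rewrite sumEFin -EFinM lee_fin; exact: cabs_sum_sqr.
Qed.

End SquareIntegral.

(** * Bounds for operators with finitely many frequencies *)

Section MultiplierBound.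
Context d (T : measurableType d) (R : realType) (mu : {measure set T -> \bar R}).
Variables (Xi : eqType) (s : seq Xi) (u : Xi -> T -> R[i]).
Implicit Types (D : set T) (b : T -> Xi -> R) (c : Xi -> R[i]).

(** Here [kappa] bounds the square of the norm of the operator with symbol [b]
    from the families of coefficients on [s] to the functions on [D]. *)
Definition symbol_bound D b (kappa : R) : Prop :=
  (forall xi, xi \in s -> measurable_fun D (b^~ xi)) /\
  forall c, (sqint mu D (fun x => (\sum_(xi <- s) c xi * (b x xi)%:C%C * u xi x)%R) <=
             (kappa * \sum_(xi <- s) cabs (c xi) ^+ 2)%:E)%E.

Variable Omega : set T.
Hypothesis mOmega : measurable Omega.
Hypothesis mu_u : forall xi, xi \in s -> cmeasurable Omega (u xi).

Let sumc_ge0 c : 0 <= \sum_(xi <- s) cabs (c xi) ^+ 2.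
Proof. by apply: sumr_ge0 => xi _; exact: sqr_ge0. Qed.

Lemma cmeasurable_symbol D b c : measurable D -> D `<=` Omega ->
  (forall xi, xi \in s -> measurable_fun D (b^~ xi)) ->
  cmeasurable D (fun x => \sum_(xi <- s) c xi * (b x xi)%:C%C * u xi x).
Proof.
move=> mD DO mb; apply: cmeasurable_sum => xi sxi.
apply: cmeasurableM; last exact: cmeasurableS (mu_u sxi).
by apply/cmeasurableZ/cmeasurable_real/mb.
Qed.

Lemma eq_symbol_bound D b b' kappa :
  (forall x xi, D x -> xi \in s -> b x xi = b' x xi) ->
  symbol_bound D b kappa -> symbol_bound D b' kappa.
Proof.
move=> bb' [mb Hb]; split=> [xi sxi|c].
  by apply: eq_measurable_fun (mb _ sxi) => x; rewrite inE => Dx; exact: bb'.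
rewrite (@eq_sqint _ _ _ mu D _ (fun x => \sum_(xi <- s) c xi * (b x xi)%:C%C * u xi x)).
  exact: Hb.
move=> x; rewrite inE => Dx; rewrite big_seq [RHS]big_seq; apply: eq_bigr => xi sxi.
by rewrite bb'.
Qed.

Lemma symbol_bound_le D b kappa kappa' : kappa <= kappa' ->
  symbol_bound D b kappa -> symbol_bound D b kappa'.
Proof.
move=> kk [mb Hb]; split=> // c; apply: le_trans (Hb c) _.
by rewrite lee_fin ler_wpM2r.
Qed.

(** The factor [W ^+ 2] comes from the multiplication by the [w nu], one factor
    [k] from the Cauchy-Schwarz inequality for the sum over [nu], the other one
    from adding up its [k] terms. *)
Lemma symbol_bound_wsum D k (w : 'I_k -> T -> R) (b : 'I_k -> T -> Xi -> R) W kappa :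
  measurable D -> D `<=` Omega -> 0 <= W ->
  (forall nu, measurable_fun D (w nu)) ->
  (forall nu x, D x -> `|w nu x| <= W) ->
  (forall nu, symbol_bound D (b nu) kappa) ->
  symbol_bound D (fun x xi => \sum_nu w nu x * b nu x xi)
    ((k%:R * W) ^+ 2 * kappa).
Proof.
move=> mD DO W0 mw wW Hb; split=> [xi sxi|c].
  by apply: measurable_sum => nu; apply: measurable_funM => //; have [+ _] := Hb nu; apply.
pose F nu x := \sum_(xi <- s) c xi * (b nu x xi)%:C%C * u xi x.
have mF nu : cmeasurable D (F nu).
  by apply: cmeasurable_symbol => //; have [] := Hb nu.
have mwF nu : cmeasurable D (fun x => (w nu x)%:C%C * F nu x).
  by apply: cmeasurableM => //; exact: cmeasurable_real.
rewrite (@eq_sqint _ _ _ mu D _ (fun x => \sum_nu (w nu x)%:C%C * F nu x)); last first.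
  move=> x _; rewrite /F; under [RHS]eq_bigr do rewrite mulr_sumr.
  rewrite exchange_big /=; apply: eq_bigr => xi _.
  rewrite rmorph_sum /= mulr_sumr mulr_suml; apply: eq_bigr => nu _.
  by rewrite rmorphM /=; ring.
apply: le_trans (sqint_sum mu mD mwF) _.
apply: (@le_trans _ _ (k%:R%:E * \sum_(nu < k)
    (W ^+ 2 * (kappa * \sum_(xi <- s) cabs (c xi) ^+ 2))%:E)%E).
  rewrite lee_wpmul2l ?lee_fin //; apply: lee_sum => nu _.
  apply: le_trans (sqint_mul mu mD (mwF nu) (mF nu) W0 _) _.
    by move=> x Dx; rewrite cabsM cabs_real ler_wpM2r ?cabs_ge0 ?wW.
  by rewrite [leRHS]EFinM lee_wpmul2l ?lee_fin ?sqr_ge0 //; have [_] := Hb nu; apply.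
rewrite sumEFin -EFinM lee_fin sumr_const card_ord -[X in _ * X <= _]mulr_natl.
by rewrite le_eqVlt; apply/orP; left; apply/eqP; ring.
Qed.

(** The triangle inequality for operator norms. The weight [eta' / eta] is the
    one for which the weighted inequality between squares is sharp. *)
Lemma symbol_boundD D b b' eta eta' : measurable D -> D `<=` Omega ->
  0 < eta -> 0 < eta' ->
  symbol_bound D b (eta ^+ 2) -> symbol_bound D b' (eta' ^+ 2) ->
  symbol_bound D (fun x xi => b x xi + b' x xi) ((eta + eta') ^+ 2).
Proof.
move=> mD DO e0 e0' [mb Hb] [mb' Hb']; split=> [xi sxi|c].
  by apply: measurable_funD; [exact: mb|exact: mb'].
pose F b x := \sum_(xi <- s) c xi * (b x xi : R)%:C%C * u xi x.
rewrite (@eq_sqint _ _ _ mu D _ (fun x => F b x + F b' x)); last first.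
  move=> x _; rewrite /F -big_split; apply: eq_bigr => xi _ /=.
  by rewrite rmorphD /=; ring.
have t0 : 0 < eta' / eta by rewrite divr_gt0.
apply: le_trans (sqint_weighted mu mD (cmeasurable_symbol c mD DO mb)
  (cmeasurable_symbol c mD DO mb') t0) _.
set S := \sum_(xi <- s) _.
apply: (@le_trans _ _ ((1 + eta' / eta)%:E * (eta ^+ 2 * S)%:E +
    (1 + (eta' / eta)^-1)%:E * (eta' ^+ 2 * S)%:E)%E).
  by apply: leeD; rewrite lee_wpmul2l ?lee_fin ?addr_ge0 ?invr_ge0 ?(ltW t0).
rewrite -!EFinM -EFinD lee_fin le_eqVlt; apply/orP; left; apply/eqP.
by field; rewrite !lt0r_neq0.
Qed.

(** Square integrals over disjoint pieces add up, so the operator norm grows only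
    like the square root of the number of pieces. *)
Lemma symbol_bound_pieces (J : finType) (P : J -> set T) b kappa :
  (forall j, measurable (P j)) -> trivIset setT P -> \bigcup_j P j = Omega ->
  (forall j, symbol_bound (P j) b kappa) -> symbol_bound Omega b (#|J|%:R * kappa).
Proof.
move=> mP tP UP Hb.
have UP' : \big[setU/set0]_(j <- enum J) P j = Omega.
  rewrite -UP -bigcup_seq; apply: eq_bigcupl; split=> j //= _.
  by rewrite mem_enum.
have mbO xi : xi \in s -> measurable_fun Omega (b^~ xi).
  move=> sxi; rewrite -UP'; elim: (enum J) => [|j l IH].
    by rewrite big_nil; exact: measurable_fun_set0.
  rewrite big_cons; apply/measurable_funU => //.
    by apply: bigsetU_measurable => i _.
  by split=> //; have [+ _] := Hb j; apply.
split=> // c; rewrite /sqint -{1}UP' ge0_integral_bigsetU //; last 4 first.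
- exact: enum_uniq.
- by apply: sub_trivIset tP.
- by rewrite UP'; apply/measurable_cabs2/cmeasurable_symbol.
- by move=> x _; rewrite lee_fin sqr_ge0.
apply: (@le_trans _ _ (\sum_(j <- enum J) (kappa * \sum_(xi <- s) cabs (c xi) ^+ 2)%:E)%E).
  by apply: lee_sum => j _; have [_] := Hb j; apply.
rewrite big_enum sumEFin sumr_const lee_fin -[X in X <= _]mulr_natl mulrA.
by rewrite (_ : #|_| = #|J|).
Qed.

Variable beta : R.
Hypothesis beta_ge0 : 0 <= beta.
Hypothesis u_bessel : forall c,
  (sqint mu Omega (fun x => (\sum_(xi <- s) c xi * u xi x)%R) <=
   (beta * \sum_(xi <- s) cabs (c xi) ^+ 2)%:E)%E.

(** A symbol independent of the point is absorbed into the coefficients, and the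
    hypothesis on [u] applies to them. *)
Lemma symbol_bound_cst D (m : Xi -> R) delta : measurable D -> D `<=` Omega ->
  (forall xi, xi \in s -> `|m xi| <= delta) ->
  symbol_bound D (fun _ xi => m xi) (beta * delta ^+ 2).
Proof.
move=> mD DO md; split=> [xi sxi|c]; first exact: measurable_cst.
pose c' xi := c xi * (m xi)%:C%C.
apply: le_trans (_ : sqint mu Omega (fun x => (\sum_(xi <- s) c' xi * u xi x)%R) <= _)%E.
  apply: ge0_subset_integral => //; last by move=> x _; rewrite lee_fin sqr_ge0.
  by apply/measurable_cabs2/cmeasurable_sum => xi sxi; exact/cmeasurableZ/mu_u.
apply: le_trans (u_bessel c') _; rewrite lee_fin -mulrA ler_wpM2l //.
rewrite mulr_sumr big_seq [leRHS]big_seq; apply: ler_sum => xi sxi.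
rewrite /c' cabsM cabs_real exprMn mulrC ler_wpM2r ?sqr_ge0 //.
by rewrite ler_sqr ?nnegrE ?md // (le_trans _ (md _ sxi)).
Qed.

Variable upsilon : R.
Hypothesis u_norm : forall xi, xi \in s -> (sqint mu Omega (u xi) <= upsilon%:E)%E.

(** For finitely many frequencies a uniformly small symbol is negligible, at a
    cost depending on their number; in the limit the cost disappears. *)
Lemma symbol_bound_limit b eta : 0 < eta ->
  (forall xi, xi \in s -> measurable_fun Omega (b^~ xi)) ->
  (forall eps, 0 < eps -> exists2 b', symbol_bound Omega b' (eta ^+ 2) &
    forall x xi, Omega x -> xi \in s -> `|b x xi - b' x xi| <= eps) ->
  symbol_bound Omega b (eta ^+ 2).
Proof.
move=> e0 mb app.
have close eps : 0 < eps -> symbol_bound Omega b ((eta + eps) ^+ 2).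
  move=> eps0.
  pose A := (size s)%:R * `|upsilon|.
  have A0 : 0 <= A by rewrite mulr_ge0.
  have A1 : 0 < A + 1 by rewrite ltr_wpDl.
  have [b' Hb' bb'] := app (eps / (A + 1)) (divr_gt0 eps0 A1).
  apply: (@eq_symbol_bound _ (fun x xi => b' x xi + (b x xi - b' x xi))).
    by move=> x xi _ _; rewrite addrC subrK.
  apply: symbol_boundD => //; have [mb' _] := Hb'; split=> [xi sxi|c].
    by apply: measurable_funB; [exact: mb|exact: mb'].
  pose F xi x := c xi * (b x xi - b' x xi)%:C%C * u xi x.
  have mF xi : xi \in s -> cmeasurable Omega (F xi).
    move=> sxi; apply: cmeasurableM (mu_u sxi); apply/cmeasurableZ/cmeasurable_real.
    by apply: measurable_funB; [exact: mb|exact: mb'].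
  rewrite (@eq_sqint _ _ _ mu Omega _
    (fun x => \sum_(i < size s) F (tnth (in_tuple s) i) x)); last first.
    by move=> x _; rewrite [in LHS]big_tnth.
  apply: le_trans (sqint_sum mu mOmega _) _; first by move=> i; exact/mF/mem_tnth.
  rewrite -(big_tnth _ _ s xpredT (fun xi => sqint mu Omega (F xi))).
  apply: (@le_trans _ _ ((size s)%:R%:E * \sum_(xi <- s)
      ((cabs (c xi) * (eps / (A + 1))) ^+ 2 * `|upsilon|)%:E)%E).
    rewrite lee_wpmul2l ?lee_fin // big_seq [leRHS]big_seq; apply: lee_sum => xi sxi.
    apply: le_trans (@sqint_mul _ _ _ mu _ (cabs (c xi) * (eps / (A + 1))) _ _
      mOmega (mF _ sxi) (mu_u sxi) _ _) _.
    - by rewrite mulr_ge0 ?cabs_ge0 // divr_ge0 // ltW.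
    - move=> x Ox; rewrite !cabsM cabs_real ler_wpM2r ?cabs_ge0 //.
      by rewrite ler_wpM2l ?cabs_ge0 ?bb'.
    rewrite [leRHS]EFinM lee_wpmul2l ?lee_fin ?sqr_ge0 //.
    by apply: le_trans (u_norm sxi) _; rewrite lee_fin ler_norm.
  rewrite sumEFin -EFinM lee_fin.
  have -> : \sum_(xi <- s) (cabs (c xi) * (eps / (A + 1))) ^+ 2 * `|upsilon| =
      (eps / (A + 1)) ^+ 2 * `|upsilon| * \sum_(xi <- s) cabs (c xi) ^+ 2.
    by rewrite mulr_sumr; apply: eq_bigr => xi _; rewrite exprMn; ring.
  rewrite mulrA ler_wpM2r //.
  have -> : (size s)%:R * ((eps / (A + 1)) ^+ 2 * `|upsilon|) = eps ^+ 2 * (A / (A + 1) ^+ 2).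
    by rewrite /A exprMn exprVn; ring.
  rewrite ler_piMr ?sqr_ge0 // ler_pdivrMr ?exprn_gt0 // mul1r sqrrD1.
  by have := sqr_ge0 A; move: A0; lra.
split=> // c; set S := \sum_(xi <- s) _.
set q := sqint _ _ _.
have qfin : q \is a fin_num.
  rewrite ge0_fin_numE ?sqint_ge0 //.
  by have [_ /(_ c)/le_lt_trans] := close 1 ltr01; apply; rewrite ltry.
have S0 : 0 <= S by exact: sumc_ge0.
rewrite -(fineK qfin) lee_fin; apply/ler_addgt0Pr => e e_gt0.
pose M := (2 * eta + 1) * S + 1.
have M0 : 0 < M by rewrite ltr_wpDl // mulr_ge0 // addr_ge0 // mulr_ge0 // ltW.
pose eps := Num.min 1 (e / M).
have eps0 : 0 < eps by rewrite lt_min ltr01 divr_gt0.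
have [_ /(_ c)] := close eps eps0; rewrite -/q -/S -(fineK qfin) lee_fin => /le_trans; apply.
have eps1 : eps <= 1 by rewrite ge_min lexx.
have epsM : eps * M <= e by rewrite -ler_pdivlMr // ge_min lexx orbT.
have -> : (eta + eps) ^+ 2 * S = eta ^+ 2 * S + eps * (2 * eta + eps) * S by ring.
rewrite lerD2l (le_trans _ epsM) // -mulrA ler_wpM2l ?(ltW eps0) //.
by rewrite /M (le_trans (_ : _ <= (2 * eta + 1) * S)) ?ler_wpM2r ?lerD2l ?lerDl.
Qed.

End MultiplierBound.

(** * Open sets and boxes; symbols obtained by interpolation *)

Section EuclideanTopology.
Variables (R : realType) (n : nat).
Local Notation X := 'rV[R]_n.

Lemma measurable_coord (D : set X) (i : 'I_n) : measurable_fun D (fun x : X => x ord0 i).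
Proof. exact: measurable_funTS (@measurable_rV_coord _ R n i). Qed.

Lemma measurable_box (A : 'I_n -> set R) : (forall i, measurable (A i)) ->
  measurable [set x : X | forall i, A i (x ord0 i)].
Proof.
move=> mA; rewrite (_ : mkset _ = \big[setI/setT]_(i < n) (@rV_coord _ R n i @^-1` A i)).
  apply: bigsetI_measurable => i _; rewrite -[X in measurable X]setTI.
  exact: measurable_rV_coord.
apply/seteqP; split => x; rewrite -bigcap_seq /=.
  by move=> Ax i _; exact: Ax.
by move=> Ax i; apply: Ax; rewrite /= mem_index_enum.
Qed.

Lemma open_box (U : set X) x : open U -> U x ->
  exists2 e : R, 0 < e & forall y : X, (forall i, `|x ord0 i - y ord0 i| < e) -> U y.
Proof.
rewrite openE => oU /oU /nbhs_ballP[e /= e0 xeU]; exists e => // y xy.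
apply: xeU; split=> // i j; rewrite ord1; exact: xy.
Qed.

(** An open set is the union of the boxes with rational center and radius that it
    contains, and there are countably many of them. *)
Lemma open_measurable_rV (U : set X) : open U -> measurable U.
Proof.
move=> oU.
pose box (p : {ffun 'I_n -> rat} * nat) : set X :=
  [set x | forall i, `]ratr (p.1 i) - p.2.+1%:R^-1,
                       ratr (p.1 i) + p.2.+1%:R^-1[%classic (x ord0 i)].
pose F p := if `[< box p `<=` U >] then box p else set0.
rewrite (_ : U = \bigcup_p F p).
  apply: countable_bigcupT_measurable => [|p]; first exact: countableP.
  by rewrite /F; case: ifP => // _; exact: (measurable_box (fun i => measurable_itv
      (Interval (BRight (ratr (p.1 i) - p.2.+1%:R^-1))
                (BLeft (ratr (p.1 i) + p.2.+1%:R^-1))))).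
apply/seteqP; split=> [x Ux|x [p _]]; last first.
  by rewrite /F; case: ifPn => // /asboolP; exact.
have [e e0 xeU] := open_box oU Ux.
have [r re] : exists r : nat, r.+1%:R^-1 < e / 2.
  have e20 : 0 < e / 2 by rewrite divr_gt0.
  exists (Num.truncn (e / 2)^-1); rewrite -[ltRHS]invrK ltf_pV2 ?posrE ?invr_gt0 //.
  have e2V : 0 <= (e / 2)^-1 by rewrite invr_ge0 ltW.
  by have /andP[_] := truncn_itv e2V.
have /choice[q Hq] : forall i : 'I_n, exists q : rat,
    x ord0 i - r.+1%:R^-1 < ratr q < x ord0 i + r.+1%:R^-1.
  move=> i; have [|q] := @rat_in_itvoo R (x ord0 i - r.+1%:R^-1) (x ord0 i + r.+1%:R^-1).
    by rewrite ltrBlDr -addrA ltrDl addr_gt0.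
  by rewrite in_itv /=; exists q.
exists ([ffun i => q i], r) => //; rewrite /F; case: ifPn => [_|/asboolP[]].
  move=> i /=; rewrite in_itv /= ffunE; have := Hq i.
  move: (r.+1%:R^-1) (ratr (q i)) => t w /andP[h1 h2].
  by apply/andP; split; lra.
move=> y /= Hy; apply: xeU => i; have /= := Hy i; rewrite in_itv /= ffunE.
have := Hq i; move: (r.+1%:R^-1) (ratr (q i)) re => t w te /andP[h1 h2] /andP[h3 h4].
by rewrite ltr_norml; apply/andP; split; lra.
Qed.

Lemma continuous_measurable_rV (U : set X) (f : X -> R) : open U ->
  (forall x, U x -> {for x, continuous f}) -> measurable_fun U f.
Proof.
move=> oU cf mU; apply: (measurability _ (RGenOpens.measurableE R)) => //.
move=> _ [_ [a [b ->] <-]]; apply: open_measurable_rV.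
rewrite openE => x [Ux fx]; apply: filterI.
  by move: oU; rewrite openE; exact.
by apply: (cf x Ux); apply: open_nbhs_nbhs; split=> //; exact: interval_open.
Qed.

Lemma compact_open_gap (K U : set X) : compact K -> open U -> K `<=` U ->
  exists2 e : R, 0 < e & forall x y : X, K x -> (forall i, `|x ord0 i - y ord0 i| < e) -> U y.
Proof.
move=> /compact_near_coveringP cK oU KU.
have [|e /= e0 He] := cK _ (0^'+ : set_system R)
    (fun e (x : X) => forall y : X, (forall i, `|x ord0 i - y ord0 i| < e) -> U y).
  move=> x /KU /(open_box oU)[e e0 xeU].
  exists (ball x (e / 2), [set t | t < e / 2]) => /=.
    split; first by apply: nbhsx_ballx; rewrite divr_gt0.
    by apply: nbhs_right_lt; rewrite divr_gt0.
  move=> [z t] /= [xz te] y zy; apply: xeU => i.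
  have h1 := xz.2 ord0 i; have h2 := zy i.
  rewrite /ball /= in h1.
  have -> : x ord0 i - y ord0 i = (x ord0 i - z ord0 i) + (z ord0 i - y ord0 i) by ring.
  rewrite (le_lt_trans (ler_normD _ _)) //; lra.
exists (e / 2); first by rewrite divr_gt0.
move=> x y Kx; apply: He => //=; last by rewrite divr_gt0.
by rewrite sub0r normrN gtr0_norm ?divr_gt0 // ltr_pdivrMr // ltr_pMr // ltr1n.
Qed.

Lemma bounded_set_coord (D : set X) : bounded_set D ->
  exists2 rho : R, 0 < rho & forall x i, D x -> `|x ord0 i| < rho.
Proof.
move=> [M [Mreal DM]]; exists (`|M| + 2); first by rewrite ltr_wpDl.
move=> x i Dx; apply: (@le_lt_trans _ _ (`|M| + 1)); last by rewrite ltrD2l ltr1n.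
apply: le_trans (DM (`|M| + 1) _ x Dx); last first.
  by rewrite (le_lt_trans (ler_norm M)) // ltrDl.
have /mapP[j Hj ->] : `|x ord0 i| \in [seq `|x y.1 y.2| | y : 'I_1 * 'I_n].
  by apply/mapP; exists (ord0, i) => //=; rewrite mem_enum.
by rewrite [leRHS]/Num.norm /= mx_normrE; apply/bigmax_geP; right => /=; exists j.
Qed.

End EuclideanTopology.

Section InterpolatedSymbol.
Variables (R : realType) (n k : nat).
Hypothesis k_gt0 : (0 < k)%N.
Local Notation X := 'rV[R]_n.
Variables (mu : {measure set X -> \bar R}) (Xi : eqType) (s : seq Xi) (u : Xi -> X -> R[i]).
Variables (Omega : set X) (beta B : R).
Hypothesis mOmega : measurable Omega.
Hypothesis mu_u : forall xi, xi \in s -> cmeasurable Omega (u xi).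
Hypothesis beta_ge0 : 0 <= beta.
Hypothesis u_bessel : forall c,
  (sqint mu Omega (fun x => (\sum_(xi <- s) c xi * u xi x)%R) <=
   (beta * \sum_(xi <- s) cabs (c xi) ^+ 2)%:E)%E.
Hypothesis B_ge1 : 1 <= B.
Hypothesis lagr_le : forall nu (t : R), 0 <= t <= k%:R -> `|(@lagr R k nu).[t]| <= B.

Definition freeze (sigma : 'I_n -> option R) (x : X) : X :=
  \row_i odflt (x ord0 i) (sigma i).

Lemma measurable_horner_coord (p : {poly R}) D (i : 'I_n) sigma (o e : R) :
  measurable_fun D (fun x : X => p.[(freeze sigma x ord0 i - o) / e]).
Proof.
apply: (@measurable_comp _ _ _ _ _ _ setT (fun t : R => p.[(t - o) / e])) => //.
  apply: continuous_measurable_fun => t.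
  apply: (@continuous_comp _ _ _ (fun t : R => (t - o) / e) (horner p)); last first.
    exact: continuous_horner.
  by apply: cvgM; [apply: cvgB; [exact: cvg_id|exact: cvg_cst]|exact: cvg_cst].
rewrite /freeze; case Es : (sigma i) => [t|].
  rewrite (_ : (fun x => _) = fun=> t); first exact: measurable_cst.
  by apply/funext => x; rewrite mxE Es.
rewrite (_ : (fun x => _) = fun x : X => x ord0 i); first exact: measurable_coord.
by apply/funext => x; rewrite mxE Es.
Qed.

(** Interpolation makes a symbol a finite combination of products of a bounded
    function of [x] and a function of the frequency: the values of the symbol
    at the nodes. Expanding one variable at a time freezes its coordinate. *)
Lemma symbol_bound_interp (D : set X) (o : 'I_n -> R) (e : R) (G : Xi -> X -> R) delta :
  measurable D -> D `<=` Omega -> D `<=` cube k o e -> 0 < e ->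
  (forall xi x, xi \in s -> cube k o e x -> `|G xi x| <= delta) ->
  symbol_bound mu s u D (fun x xi => interp k o e (enum 'I_n) (G xi) x)
    (((k%:R * B) ^+ 2) ^+ n * (beta * delta ^+ 2)).
Proof.
move=> mD DO DQ e0 Gd.
have cubeA sigma x : (forall i t, sigma i = Some t -> o i <= t <= o i + e * k%:R) ->
    cube k o e x -> cube k o e (freeze sigma x).
  move=> Hs Qx i; rewrite mxE; case Es : (sigma i) => [t|] //=; exact: Hs.
suff H l sigma : (forall i t, sigma i = Some t -> o i <= t <= o i + e * k%:R) ->
    (forall i, sigma i = None -> i \in l) ->
    symbol_bound mu s u D (fun x xi => interp k o e l (G xi) (freeze sigma x))
      (((k%:R * B) ^+ 2) ^+ size l * (beta * delta ^+ 2)).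
  have := H (enum 'I_n) (fun=> None); rewrite size_enum_ord.
  move=> /(_ (fun i t => ltac:(done)) (fun i _ => mem_enum _ _)).
  apply: eq_symbol_bound => x xi _ _; congr (interp _ _ _ _ _ _).
  by apply/rowP => i; rewrite mxE.
elim: l sigma => [|i l IH] sigma Hs Hn.
  rewrite expr0 mul1r.
  have Qc : cube k o e (\row_i o i).
    by move=> i; rewrite mxE lexx lerDl mulr_ge0 // ltW.
  apply: (@eq_symbol_bound _ _ _ _ _ _ _ _ (fun _ xi => G xi (freeze sigma (\row_i o i)))).
    move=> x xi _ _ /=; congr (G xi _); apply/rowP => i; rewrite !mxE.
    by case Es : (sigma i) => [t|] //; have := Hn _ Es.
  apply: (symbol_bound_cst mOmega mu_u beta_ge0 u_bessel mD DO) => xi sxi.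
  by apply: Gd => //; exact: cubeA.
pose sigma' nu j := if j == i then Some (o i + e * nu%:R) else sigma j.
rewrite [_ ^+ size (i :: l)]exprS -mulrA.
apply: (@eq_symbol_bound _ _ _ _ _ _ _ _ (fun x xi => \sum_(nu < k)
    (lagr R nu).[(freeze sigma x ord0 i - o i) / e] *
    interp k o e l (G xi) (freeze (sigma' nu) x))).
  move=> x xi _ _; apply: eq_bigr => nu _; congr (_ * interp _ _ _ _ _ _).
  by apply/rowP => j; rewrite !mxE /sigma'; case: eqP.
apply: (@symbol_bound_wsum _ _ _ _ _ _ _ _ mOmega mu_u D k
  (fun nu x => (lagr R nu).[(freeze sigma x ord0 i - o i) / e])
  (fun nu x xi => interp k o e l (G xi) (freeze (sigma' nu) x))) => //.
- by rewrite (le_trans ler01).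
- by move=> nu; exact: measurable_horner_coord.
- move=> nu x Dx; apply: lagr_le; apply: cube_param => //.
  by apply: cubeA => //; exact: DQ.
move=> nu; apply: IH => j.
  rewrite /sigma'; case: eqP => [-> t [<-]|_ t]; last exact: Hs.
  exact: node_in_cube.
by rewrite /sigma'; case: eqP => // /eqP ji /Hn; rewrite inE (negbTE ji).
Qed.

End InterpolatedSymbol.

(** * The dyadic decomposition of a symbol *)

Section Multiscale.
Variables (R : realType) (n k : nat).
Hypotheses (k_gt0 : (0 < k)%N) (k_gt : (n < 2 * k)%N).
Local Notation X := 'rV[R]_n.
Variables (Omega U : set X) (rho gap : R) (N : nat).
Hypothesis rho_gt0 : 0 < rho.
Hypothesis Omega_rho : forall x i, Omega x -> `|x ord0 i| < rho.
Hypothesis Omega_gap : forall x y : X, Omega x ->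
  (forall i, `|x ord0 i - y ord0 i| < gap) -> U y.
Hypothesis N_gt0 : (0 < N)%N.
Hypothesis N_gap : 2 * rho / N%:R < gap.

(** At scale [j] the cube of center 0 and side [2 * rho] is divided into
    [N * 2 ^ j] parts in each direction. The number [N] is so large that the cubes
    of every scale that meet [Omega] are contained in [U]. *)
Definition mesh (j : nat) : R := 2 * rho / N%:R / (2 ^ j)%:R.
Definition step (j : nat) : R := mesh j / k%:R.
Definition corner (j : nat) (p : 'I_n -> nat) (i : 'I_n) : R := - rho + mesh j * (p i)%:R.
Definition idx (j : nat) (x : X) (i : 'I_n) : nat :=
  Num.truncn ((x ord0 i + rho) / mesh j).

Lemma mesh_gt0 j : 0 < mesh j.
Proof. by rewrite /mesh !divr_gt0 ?mulr_gt0 ?ltr0n ?expn_gt0. Qed.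

Lemma meshS j : mesh j = 2 * mesh j.+1.
Proof.
rewrite /mesh expnS natrM invfM; field.
by rewrite !pnatr_eq0 -!lt0n expn_gt0 N_gt0.
Qed.

Lemma mesh_le j : mesh j <= 2 * rho / N%:R.
Proof.
rewrite /mesh ler_pdivrMr ?ltr0n ?expn_gt0 // ler_peMr //.
  by rewrite divr_ge0 // mulr_ge0 // ltW.
by rewrite ler1n expn_gt0.
Qed.

Lemma step_gt0 j : 0 < step j.
Proof. by rewrite divr_gt0 ?mesh_gt0 ?ltr0n. Qed.

Lemma stepM j : step j * k%:R = mesh j.
Proof. by rewrite divfK // pnatr_eq0 -lt0n. Qed.

Lemma param_ge0 j x i : Omega x -> 0 <= (x ord0 i + rho) / mesh j.
Proof.
move=> Ox; have := Omega_rho i Ox; rewrite ltr_norml => /andP[h _].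
by rewrite divr_ge0 ?(ltW (mesh_gt0 j)) //; lra.
Qed.

Lemma idx_itv j x i : Omega x ->
  corner j (idx j x) i <= x ord0 i < corner j (idx j x) i + mesh j.
Proof.
move=> Ox; have /andP[h1 h2] := truncn_itv (param_ge0 j i Ox).
rewrite -/(idx j x i) ler_pdivlMr ?mesh_gt0 // in h1.
rewrite -/(idx j x i) ltr_pdivrMr ?mesh_gt0 // -natr1 mulrDl mul1r in h2.
rewrite /corner; apply/andP; split; lra.
Qed.

Lemma idxP j x (p : 'I_n -> nat) i : Omega x ->
  idx j x i = p i <-> corner j p i <= x ord0 i < corner j p i + mesh j.
Proof.
move=> Ox; split=> [E|/andP[h1 h2]].
  by have := idx_itv j i Ox; rewrite /corner E.
apply: truncn_def; rewrite ler_pdivlMr ?mesh_gt0 // ltr_pdivrMr ?mesh_gt0 //.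
by rewrite -natr1 mulrDl mul1r; rewrite /corner in h1 h2; apply/andP; split; lra.
Qed.

Lemma idx_lt j x i : Omega x -> (idx j x i < N * 2 ^ j)%N.
Proof.
move=> Ox; rewrite truncn_lt_nat ?param_ge0 // ltr_pdivrMr ?mesh_gt0 //.
have -> : (N * 2 ^ j)%:R * mesh j = 2 * rho.
  rewrite /mesh natrM; field.
  by rewrite !pnatr_eq0 -!lt0n expn_gt0 N_gt0.
have := Omega_rho i Ox; rewrite ltr_norml => /andP[_ h]; lra.
Qed.

Lemma half_natr (m : nat) : (m %/ 2)%:R * 2 <= (m%:R : R) < (m %/ 2)%:R * 2 + 2.
Proof.
rewrite -natrM -natrD ler_nat ltr_nat leq_trunc_div /=.
by rewrite {1}(divn_eq m 2) ltn_add2l ltn_mod.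
Qed.

(** The grids are nested: halving the index gives the parent cube. *)
Lemma idx_half j x i : Omega x -> idx j x i = (idx j.+1 x i %/ 2)%N.
Proof.
move=> Ox; apply/(idxP _ (fun i => idx j.+1 x i %/ 2)%N) => //.
have := idx_itv j.+1 i Ox; rewrite /corner (meshS j).
have := half_natr (idx j.+1 x i); set m := idx j.+1 x i.
have := mesh_gt0 j.+1; set t := mesh _.
move=> t0 /andP[h1 h2] /andP[h3 h4].
have h5 : t * ((m %/ 2)%:R * 2) <= t * m%:R by rewrite ler_pM2l.
have h6 : t * (m%:R + 1) <= t * ((m %/ 2)%:R * 2 + 2).
  by rewrite ler_pM2l // natr1 -natrM -natrD ler_nat -(ltr_nat R) natrD natrM.
apply/andP; split; nra.
Qed.

Lemma idx_cube j x : Omega x -> cube k (corner j (idx j x)) (step j) x.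
Proof.
by move=> Ox i; rewrite stepM; have /andP[-> /ltW ->] := idx_itv j i Ox.
Qed.

Lemma cube_subU j x y : Omega x -> cube k (corner j (idx j x)) (step j) y -> U y.
Proof.
move=> Ox Qy; apply: (Omega_gap Ox) => i; apply: le_lt_trans N_gap.
apply: le_trans (mesh_le j).
have := Qy i; have := idx_itv j i Ox; rewrite stepM => /andP[h1 h2] /andP[h3 h4].
by rewrite ler_norml; apply/andP; split; lra.
Qed.

Lemma cube_child j (p : 'I_n -> nat) y : cube k (corner j.+1 p) (step j.+1) y ->
  cube k (corner j (fun i => p i %/ 2)%N) (step j) y.
Proof.
move=> Qy i; have := Qy i; rewrite !stepM /corner (meshS j).
have := half_natr (p i); set m := p i.
have := mesh_gt0 j.+1; set t := mesh _.
move=> t0 /andP[h1 h2] /andP[h3 h4].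
have h5 : t * ((m %/ 2)%:R * 2) <= t * m%:R by rewrite ler_pM2l.
have h6 : t * (m%:R + 1) <= t * ((m %/ 2)%:R * 2 + 2).
  by rewrite ler_pM2l // natr1 -natrM -natrD ler_nat -(ltr_nat R) natrD natrM.
apply/andP; split; nra.
Qed.

Definition grid (j : nat) := {ffun 'I_n -> 'I_(N * 2 ^ j)}.

Definition piece (j : nat) (p : grid j) : set X :=
  [set x | Omega x /\ forall i, idx j x i = p i].

Lemma card_grid j : #|{: grid j}| = ((N * 2 ^ j) ^ n)%N.
Proof. by rewrite card_ffun !card_ord. Qed.

Lemma measurable_piece j (p : grid j) : measurable Omega -> measurable (piece p).
Proof.
move=> mO; rewrite (_ : piece p = Omega `&` [set x | forall i,
    `[corner j (fun i => p i) i, corner j (fun i => p i) i + mesh j[%classic (x ord0 i)]).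
  apply: measurableI => //.
  exact: (measurable_box (fun i => measurable_itv (Interval
    (BLeft (corner j (fun i => p i) i)) (BLeft (corner j (fun i => p i) i + mesh j))))).
apply/seteqP; split=> x [Ox H]; split=> // i /=.
  by rewrite in_itv /=; apply/idxP.
by have /= := H i; rewrite in_itv /= => Hi; apply/(idxP _ (fun i => nat_of_ord (p i))).
Qed.

Lemma trivIset_piece j : trivIset setT (@piece j).
Proof.
apply/trivIsetP => p q _ _ pq; rewrite -subset0 => x [[_ Hp] [_ Hq]].
by case/eqP: pq; apply/ffunP => i; apply/val_inj; rewrite /= -Hp Hq.
Qed.

Lemma bigcup_piece j : \bigcup_p @piece j p = Omega.
Proof.
apply/seteqP; split=> [x [p _ []]//|x Ox].
exists [ffun i => Ordinal (idx_lt j i Ox)] => //; split=> // i.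
by rewrite ffunE.
Qed.

(** The cube in which [g] is interpolated is the one that contains [x], so this is
    piecewise a polynomial in [x]. *)
Definition level (j : nat) (g : X -> R) (x : X) : R :=
  interp k (corner j (idx j x)) (step j) (enum 'I_n) g x.

Variables (B M : R).
Hypothesis B_ge1 : 1 <= B.
Hypothesis lagr_le : forall nu (t : R), 0 <= t <= k%:R -> `|(@lagr R k nu).[t]| <= B.

Definition scale_error (j : nat) : R := interp_const k B n * (M * mesh j ^+ k).

Section OneFunction.
Variable g : X -> R.
Hypothesis g_Ck : real_Ck k U g.
Hypothesis g_le : forall i x, U x -> `|iter k (partial i) g x| <= M.

Lemma interp_error_cube j x y : Omega x ->
  cube k (corner j (idx j x)) (step j) y ->
  `|g y - interp k (corner j (idx j x)) (step j) (enum 'I_n) g y| <= scale_error j.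
Proof.
move=> Ox Qy; rewrite /scale_error distrC -(stepM j).
have := @interp_error R n k k_gt0 _ _ B lagr_le (step_gt0 j) g
  (M * (step j * k%:R) ^+ k) _ (enum 'I_n) y Qy.
rewrite size_enum_ord; apply.
apply: (real_Ck_line_poly (ltW (step_gt0 j)) g_Ck _ g_le) => z.
exact: cube_subU.
Qed.

Lemma level_error j x : Omega x -> `|g x - level j g x| <= scale_error j.
Proof. by move=> Ox; apply: interp_error_cube => //; exact: idx_cube. Qed.

End OneFunction.

(** The coarse interpolation is a polynomial in each variable, hence it is
    reproduced by the fine one. So the difference is the fine interpolation of
    the coarse error, and the values of that error at the nodes are small. *)
Lemma levelBE j (p : grid j.+1) g x : piece p x ->
  level j.+1 g x - level j g x =
  interp k (corner j.+1 (fun i => p i)) (step j.+1) (enum 'I_n)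
    (fun y => g y - interp k (corner j (fun i => p i %/ 2)%N) (step j) (enum 'I_n) g y) x.
Proof.
move=> [Ox Hp]; rewrite interpB /level.
have -> : idx j.+1 x = (fun i => p i : nat) by apply/funext => i; exact: Hp.
have -> : idx j x = (fun i => p i %/ 2)%N.
  by apply/funext => i; rewrite idx_half // Hp.
congr (_ - _); rewrite [RHS]interp_reproduce //; first by rewrite lt0r_neq0 ?step_gt0.
by move=> i; apply: poly_in_interp; rewrite ?mem_enum.
Qed.

Section SymbolBounds.
Variables (mu : {measure set X -> \bar R}) (beta : R).
Hypotheses (oOmega : open Omega) (beta_ge0 : 0 <= beta).
Let mOmega := open_measurable_rV oOmega.

(** These bound the squared norms of the operators of the coarsest approximation
    and, up to the factor [2 ^ (- j)], of the passage from scale [j] to scale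
    [j + 1]. The last factor of each is the bound for one cube, the first one
    counts the cubes. *)
Definition coarse_bound : R := (N ^ n)%:R * (((k%:R * B) ^+ 2) ^+ n * (beta * M ^+ 2)).
Definition fine_bound : R :=
  ((2 * N) ^ n)%:R * (((k%:R * B) ^+ 2) ^+ n * (beta * scale_error 0 ^+ 2)).
(** The norms of the successive differences are dominated by a geometric series
    of ratio [2 ^ (- 1 / 2)]. The summands 1 make the bounds positive. *)
Definition total_bound : R :=
  (1 + coarse_bound) + (1 + fine_bound) / (1 - Num.sqrt 2^-1).

Let ratio : R := Num.sqrt 2^-1.
Let ratio_sqr : ratio ^+ 2 = 2^-1.
Proof. by rewrite sqr_sqrtr // invr_ge0. Qed.
Let ratio_gt0 : 0 < ratio.
Proof. by rewrite sqrtr_gt0 invr_gt0. Qed.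
Let ratio_lt1 : ratio < 1.
Proof.
rewrite -(@ltr_pXn2r _ 2) ?nnegrE ?(ltW ratio_gt0) // ratio_sqr expr1n.
by rewrite invf_lt1 // ltr1n.
Qed.

Lemma scale_errorE j : scale_error j = scale_error 0 / (2 ^ (j * k))%:R.
Proof.
rewrite /scale_error /mesh expn0 divr1 expnM !natrX [in LHS]exprMn exprVn.
by rewrite !mulrA.
Qed.

Lemma interp_bound_ge0 (t : R) : 0 <= ((k%:R * B) ^+ 2) ^+ n * (beta * t ^+ 2).
Proof. by apply: mulr_ge0; [apply: exprn_ge0|apply: mulr_ge0 => //]; exact: sqr_ge0. Qed.

Lemma coarse_bound_ge0 : 0 <= coarse_bound.
Proof. by apply: mulr_ge0 => //; exact: interp_bound_ge0. Qed.

Lemma fine_bound_ge0 : 0 <= fine_bound.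
Proof. by apply: mulr_ge0 => //; exact: interp_bound_ge0. Qed.

Lemma total_bound_gt0 : 0 < total_bound.
Proof.
rewrite ltr_pwDl // ?ltr_pwDl ?coarse_bound_ge0 //.
apply: divr_ge0; last by rewrite subr_ge0 ltW.
by rewrite addr_ge0 ?fine_bound_ge0.
Qed.

Variables (Xi : eqType) (s : seq Xi) (u : Xi -> X -> R[i]) (upsilon : R).
Hypothesis mu_u : forall xi, xi \in s -> cmeasurable Omega (u xi).
Hypothesis u_bessel : forall c,
  (sqint mu Omega (fun x => (\sum_(xi <- s) c xi * u xi x)%R) <=
   (beta * \sum_(xi <- s) cabs (c xi) ^+ 2)%:E)%E.
Hypothesis u_norm : forall xi, xi \in s -> (sqint mu Omega (u xi) <= upsilon%:E)%E.
Variable g : Xi -> X -> R.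
Hypothesis g_Ck : forall xi, xi \in s -> real_Ck k U (g xi).
Hypothesis g_le : forall xi i x, xi \in s -> U x -> `|iter k (partial i) (g xi) x| <= M.
Hypothesis g_le0 : forall xi x, xi \in s -> U x -> `|g xi x| <= M.

Lemma symbol_bound_set0 (b : X -> Xi -> R) kappa :
  0 <= kappa -> symbol_bound mu s u set0 b kappa.
Proof.
move=> k0; split=> [xi _|c]; first exact: measurable_fun_set0.
rewrite /sqint integral_set0 lee_fin mulr_ge0 // sumr_ge0 // => xi _.
exact: sqr_ge0.
Qed.

Lemma piece_dec j (p : grid j) : piece p = set0 \/ exists x, piece p x.
Proof.
case: (pselect (exists x, piece p x)) => [|H]; [by right|left].
by apply/seteqP; split=> // x px; case: H; exists x.
Qed.

Lemma pieceO j (p : grid j) : piece p `<=` Omega.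
Proof. by move=> x []. Qed.

Lemma piece_idx j (p : grid j) x : piece p x -> idx j x = (fun i => p i : nat).
Proof. by move=> [_ Hp]; apply/funext. Qed.

Lemma symbol_bound_coarse :
  symbol_bound mu s u Omega (fun x xi => level 0 (g xi) x) coarse_bound.
Proof.
have -> : coarse_bound = #|{: grid 0}|%:R * (((k%:R * B) ^+ 2) ^+ n * (beta * M ^+ 2)).
  by rewrite card_grid expn0 muln1.
apply: (symbol_bound_pieces mOmega mu_u (fun p => measurable_piece p mOmega)
  (@trivIset_piece 0) (bigcup_piece 0)) => p.
have [->|[x0 px0]] := piece_dec p.
  by apply: symbol_bound_set0; exact: interp_bound_ge0.
have Ox0 := pieceO px0.
apply: (@eq_symbol_bound _ _ _ _ _ _ _ _ (fun x xi =>
    interp k (corner 0 (fun i => p i)) (step 0) (enum 'I_n) (g xi) x)).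
  by move=> x xi px _; rewrite /level (piece_idx px).
apply: (symbol_bound_interp mOmega mu_u beta_ge0 u_bessel B_ge1 lagr_le) => //.
- exact: (measurable_piece p mOmega).
- exact: pieceO.
- by move=> x px; rewrite -(piece_idx px); apply/idx_cube/pieceO/px.
- exact: step_gt0.
move=> xi x sxi; rewrite -(piece_idx px0) => /(cube_subU Ox0) Ux; exact: g_le0.
Qed.

(** There are [(N * 2 ^ (j + 1)) ^ n] cubes, and the square of the error at scale
    [j] has the factor [2 ^ (- 2 * j * k)]; since [n + 1 <= 2 * k], the product
    of the two decays like [2 ^ (- j)]. *)
Lemma symbol_bound_fine j :
  symbol_bound mu s u Omega (fun x xi => level j.+1 (g xi) x - level j (g xi) x)
    (fine_bound / 2 ^+ j).
Proof.
pose kap := ((k%:R * B) ^+ 2) ^+ n * (beta * scale_error j ^+ 2).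
apply: (@symbol_bound_le _ _ _ _ _ _ _ _ _ (#|{: grid j.+1}|%:R * kap)).
  rewrite /kap scale_errorE card_grid.
  have -> : (scale_error 0 / (2 ^ (j * k))%:R) ^+ 2 =
      scale_error 0 ^+ 2 / (2 ^ (j * k * 2))%:R.
    by rewrite exprMn exprVn -natrX -expnM.
  rewrite expnS mulnA [(N * 2)%N]mulnC expnMn [in leLHS]natrM -expnM /fine_bound.
  set A := ((2 * N) ^ n)%:R; set K := (_ ^+ 2) ^+ n; set E := scale_error 0 ^+ 2.
  have -> : A * (2 ^ (j * n))%:R * (K * (beta * (E / (2 ^ (j * k * 2))%:R))) =
     A * (K * (beta * E)) * ((2 ^ (j * n))%:R / (2 ^ (j * k * 2))%:R) by ring.
  rewrite ler_wpM2l //; first by apply: mulr_ge0 => //; exact: interp_bound_ge0.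
  rewrite ler_pdivrMr ?ltr0n ?expn_gt0 // ler_pdivlMl ?exprn_gt0 //.
  rewrite -natrX -natrM ler_nat -expnD leq_exp2l // -mulnA -mulnS leq_mul2l.
  by apply/orP; right; rewrite mulnC.
apply: (symbol_bound_pieces mOmega mu_u (fun p => measurable_piece p mOmega)
  (@trivIset_piece j.+1) (bigcup_piece j.+1)) => p.
have [->|[x0 px0]] := piece_dec p.
  by apply: symbol_bound_set0; exact: interp_bound_ge0.
have Ox0 := pieceO px0.
have idx0 : idx j x0 = (fun i => p i %/ 2)%N.
  by apply/funext => i; rewrite idx_half // (piece_idx px0).
apply: (@eq_symbol_bound _ _ _ _ _ _ _ _ (fun x xi =>
    interp k (corner j.+1 (fun i => p i)) (step j.+1) (enum 'I_n)
    (fun y => g xi y - interp k (corner j (fun i => p i %/ 2)%N) (step j) (enum 'I_n) (g xi) y) x)).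
  by move=> x xi px _; rewrite (levelBE _ px).
apply: (symbol_bound_interp mOmega mu_u beta_ge0 u_bessel B_ge1 lagr_le) => //.
- exact: (measurable_piece p mOmega).
- exact: pieceO.
- by move=> x px; rewrite -(piece_idx px); apply/idx_cube/pieceO/px.
- exact: step_gt0.
move=> xi x sxi /cube_child; rewrite -idx0 => Qx.
by apply: interp_error_cube => //; [exact: g_Ck|move=> i y; exact: g_le].
Qed.

Lemma symbol_bound_level J :
  symbol_bound mu s u Omega (fun x xi => level J (g xi) x) (total_bound ^+ 2).
Proof.
pose eta (J : nat) := (1 + coarse_bound) + (1 + fine_bound) * (1 - ratio ^+ J) / (1 - ratio).
have r1 : 0 < 1 - ratio by rewrite subr_gt0.
have cb := coarse_bound_ge0; have fb := fine_bound_ge0.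
have eta0 j : 0 < eta j.
  rewrite ltr_pwDl // ?ltr_pwDl //; apply: divr_ge0; last exact: ltW.
  apply: mulr_ge0; first exact: addr_ge0.
  by rewrite subr_ge0 exprn_ile1 // ltW.
have sqr_ge (t c : R) : 0 <= t -> 0 <= c -> c <= 1 -> t * c ^+ 2 <= ((1 + t) * c) ^+ 2.
  move=> t0 c0 c1; rewrite exprMn ler_wpM2r ?sqr_ge0 //; nra.
suff H : symbol_bound mu s u Omega (fun x xi => level J (g xi) x) (eta J ^+ 2).
  apply: symbol_bound_le H; rewrite ler_sqr ?nnegrE ?(ltW (eta0 _)) ?(ltW total_bound_gt0) //.
  rewrite lerD2l ler_wpM2r ?invr_ge0 ?(ltW r1) // ler_piMr ?addr_ge0 //.
  by rewrite gerBl exprn_ge0 // ltW.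
elim: J => [|J IH].
  apply: symbol_bound_le symbol_bound_coarse.
  rewrite /eta expr0 subrr mulr0 mul0r addr0; nra.
apply: (@eq_symbol_bound _ _ _ _ _ _ _ _ (fun x xi =>
    level J (g xi) x + (level J.+1 (g xi) x - level J (g xi) x))).
  by move=> x xi _ _; rewrite addrC subrK.
have -> : eta J.+1 = eta J + (1 + fine_bound) * ratio ^+ J.
  by rewrite /eta exprS; field; rewrite lt0r_neq0.
have rJ : 0 < ratio ^+ J by rewrite exprn_gt0.
apply: (symbol_boundD mOmega mu_u mOmega (@subset_refl _ Omega)) => //.
  by rewrite mulr_gt0 // ltr_pwDl.
apply: symbol_bound_le (symbol_bound_fine J).
have -> : fine_bound / 2 ^+ J = fine_bound * (ratio ^+ J) ^+ 2.
  by rewrite -exprM mulnC exprM ratio_sqr exprVn.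
by apply: sqr_ge => //; [exact: ltW|rewrite exprn_ile1 // ltW].
Qed.

Lemma scale_error_small eps : 0 < eps -> exists j, scale_error j <= eps.
Proof.
move=> eps0; pose a := `|scale_error 0| / eps.
have a0 : 0 <= a by rewrite divr_ge0 // ltW.
exists (Num.truncn a).+1; rewrite scale_errorE ler_pdivrMr ?ltr0n ?expn_gt0 //.
rewrite mulrC -ler_pdivrMr //; apply: le_trans (_ : a <= _).
  by rewrite ler_wpM2r ?invr_ge0 ?(ltW eps0) // ler_norm.
have /andP[_ /ltW/le_trans] := truncn_itv a0; apply.
rewrite ler_nat; apply: leq_trans (_ : 2 ^ (Num.truncn a).+1 <= _)%N.
  by rewrite ltnW // ltn_expl.
by rewrite leq_exp2l // leq_pmulr.
Qed.

Lemma symbol_bound_multiscale :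
  symbol_bound mu s u Omega (fun x xi => g xi x) (total_bound ^+ 2).
Proof.
apply: (symbol_bound_limit mOmega mu_u u_norm) => //.
- exact: total_bound_gt0.
- move=> xi sxi.
  apply: continuous_measurable_rV => // x Ox.
  have Ux : U x by apply: (@cube_subU 0 x x Ox); exact: idx_cube.
  by case: (k) (g_Ck sxi) => [|k'] [+ _]; apply.
move=> eps /scale_error_small[j Hj].
exists (fun x xi => level j (g xi) x); first exact: symbol_bound_level.
move=> x xi Ox sxi; apply: le_trans Hj.
by apply: level_error => //; [exact: g_Ck|move=> i y; exact: g_le].
Qed.

End SymbolBounds.
End Multiscale.

(** * Completeness in mean square *)

Section BoundedVariation.
Variable R : realType.

Lemma bounded_series_cvg (w : R^nat) (S : R) : (forall j, 0 <= w j) ->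
  (forall N, \sum_(0 <= j < N) w j <= S) -> cvgn (series w).
Proof.
move=> w0 wS; apply: nondecreasing_is_cvgn.
  by apply: nondecreasing_series => j _ _.
by exists S => _ [N _ <-]; exact: wS.
Qed.

Lemma bounded_variation_cvg (r : R^nat) (S : R) :
  (forall N, \sum_(0 <= j < N) `|r j.+1 - r j| <= S) -> cvgn r.
Proof.
move=> rS.
have c : cvgn (series (telescope r)).
  apply: (@normed_cvg R R^o).
  apply: (@bounded_series_cvg (fun j => `|r j.+1 - r j|) S) => [j|N]; first exact: normr_ge0.
  exact: rS.
rewrite (_ : r = fun n => r 0%N + series (telescope r) n); last first.
  by apply/funext => n; rewrite -eq_sum_telescope.
by apply: is_cvgD => //; exact: is_cvg_cst.
Qed.

Lemma cvgn_EFin (r : R^nat) (l : R) :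
  r j @[j --> \oo] --> l -> (r j)%:E @[j --> \oo] --> l%:E.
Proof. by move=> rl; apply: cvg_EFin; [exact: nearW|exact: rl]. Qed.

End BoundedVariation.

Section MeanSquareLimits.
Context d (T : measurableType d) (R : realType) (mu : {measure set T -> \bar R}).
Variable D : set T.
Hypothesis mD : measurable D.
Implicit Types (f g : T -> R[i]) (F : nat -> T -> R[i]).

Definition ccvg (z : nat -> R[i]) (l : R[i]) : Prop :=
  (complex.Re (z j) @[j --> \oo] --> complex.Re l) /\
  (complex.Im (z j) @[j --> \oo] --> complex.Im l).

Definition mean_square_limit F g : Prop := forall e : R, 0 < e ->
  exists N, forall p, (N <= p)%N -> (sqint mu D (fun x => F p x - g x)%R <= e%:E)%E.

Lemma ccvgB_cabs2 (z : nat -> R[i]) l w : ccvg z l ->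
  cabs (w - z j) ^+ 2 @[j --> \oo] --> cabs (w - l) ^+ 2.
Proof.
move=> [zr zi]; have E v : cabs (w - v) ^+ 2 =
    (complex.Re w - complex.Re v) * (complex.Re w - complex.Re v) +
    (complex.Im w - complex.Im v) * (complex.Im w - complex.Im v).
  by rewrite cabs2 !expr2; case: (w) (v) => a b [].
rewrite E (_ : (fun j => _) = fun j =>
    (complex.Re w - complex.Re (z j)) * (complex.Re w - complex.Re (z j)) +
    (complex.Im w - complex.Im (z j)) * (complex.Im w - complex.Im (z j))); last first.
  by apply/funext => j; rewrite E.
by apply: cvgD; apply: cvgM; apply: cvgB => //; exact: cvg_cst.
Qed.

Lemma measurable_limn_einf (f : nat -> T -> \bar R) :
  (forall j, measurable_fun D (f j)) -> measurable_fun D (fun x => limn_einf (f^~ x)).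
Proof.
move=> mf; rewrite (_ : (fun x => _) = fun x => (- limn_esup (fun j => - f j x))%E).
  apply: measurableT_comp; first exact: oppe_measurable.
  apply: measurable_fun_limn_esup => j.
  by apply: measurableT_comp (mf j); exact: oppe_measurable.
apply/funext => x; rewrite -limn_einfN; congr limn_einf.
by apply/funext => j /=; rewrite oppeK.
Qed.

Lemma limn_einf_le (w : (\bar R)^nat) A N : (forall j, (N <= j)%N -> (w j <= A)%E) ->
  (limn_einf w <= A)%E.
Proof.
move=> wA; rewrite limn_einf_lim; apply: lime_le; first exact: is_cvg_einfs.
exists N => // j /= Nj; apply: le_trans (wA _ Nj).
by apply: ereal_inf_lbound; exists j => /=.
Qed.

(** This is Fatou's lemma for the squared distances to [f]. *)
Lemma sqint_fatou F f g N A : (forall j, cmeasurable D (F j)) ->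
  cmeasurable D f -> cmeasurable D g ->
  {ae mu, forall x, D x -> ccvg (F^~ x) (g x)} ->
  (forall j, (N <= j)%N -> (sqint mu D (fun x => f x - F j x)%R <= A)%E) ->
  (sqint mu D (fun x => f x - g x)%R <= A)%E.
Proof.
move=> mF mf mg cF FA.
pose w j x : \bar R := (cabs (f x - F j x) ^+ 2)%:E.
have mw j : measurable_fun D (w j) by apply/measurable_cabs2/cmeasurableB.
have -> : sqint mu D (fun x => f x - g x) = (\int[mu]_(x in D) limn_einf (w^~ x))%E.
  apply: ae_eq_integral => //.
  - exact/measurable_cabs2/cmeasurableB.
  - exact: measurable_limn_einf.
  apply: filterS cF => x cx Dx.
  apply/esym; apply: (cvg_limn_einf_sup _).1.
  by apply: cvgn_EFin; exact: ccvgB_cabs2 (cx Dx).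
apply: le_trans (fatou mu mD mw _) _; first by move=> j x _; rewrite lee_fin sqr_ge0.
exact: (limn_einf_le FA).
Qed.

(** By Fatou's lemma the lower limit of the squared distances to [f] has integral
    zero, and it is the squared distance from [f] to the pointwise limit. *)
Lemma mean_square_limit_ae F f g : (forall j, cmeasurable D (F j)) ->
  cmeasurable D f -> mean_square_limit F f ->
  {ae mu, forall x, D x -> ccvg (F^~ x) (g x)} ->
  {ae mu, forall x, D x -> f x = g x}.
Proof.
move=> mF mf Ff cF.
pose w j x : \bar R := (cabs (f x - F j x) ^+ 2)%:E.
have mw j : measurable_fun D (w j) by apply/measurable_cabs2/cmeasurableB.
pose h x := limn_einf (w^~ x).
have mh : measurable_fun D h by exact: measurable_limn_einf.
have w0 j x : (0 <= w j x)%E by rewrite lee_fin sqr_ge0.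
have h0 x : (0 <= h x)%E.
  rewrite /h limn_einf_lim; apply: lime_ge; first exact: is_cvg_einfs.
  by apply: nearW => j; apply: le_ereal_inf_tmp => _ [i _ <-].
have ih : (\int[mu]_(x in D) h x = 0)%E.
  apply/eqP; rewrite eq_le integral_ge0 // andbT.
  apply: le_trans (fatou mu mD mw _) _ => //.
  apply/lee_addgt0Pr => e e0; rewrite add0e.
  have [N HN] := Ff e e0; apply: (@limn_einf_le _ _ N) => j /HN.
  by rewrite sqint_distC.
have /(ae_eq_integral_abs mu mD mh) hz : (\int[mu]_(x in D) `|h x| = 0)%E.
  by rewrite -[RHS]ih; apply: eq_integral => x _; rewrite gee0_abs.
apply: filterS2 hz cF => x hz cx Dx.
have : h x = (cabs (f x - g x) ^+ 2)%:E.
  apply: (cvg_limn_einf_sup _).1.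
  by apply: cvgn_EFin; exact: ccvgB_cabs2 (cx Dx).
rewrite hz // => -[/esym/eqP]; rewrite sqrf_eq0 => /eqP/cabs_eq0 h1.
by apply/eqP; rewrite -subr_eq0 h1.
Qed.

Lemma mean_square_limit_le F f A : (forall j, cmeasurable D (F j)) ->
  cmeasurable D f -> mean_square_limit F f ->
  (forall j, (sqint mu D (F j) <= A%:E)%E) -> (sqint mu D f <= (2 * A)%:E)%E.
Proof.
move=> mF mf Ff FA; apply/lee_addgt0Pr => e e0.
have e2 : 0 < e / 2 by rewrite divr_gt0.
have [N /(_ _ (leqnn N)) HN] := Ff _ e2.
rewrite (@eq_sqint _ _ _ mu D f (fun x => F N x + (f x - F N x))); last first.
  by move=> x _; rewrite addrC subrK.
apply: le_trans (sqintD mu mD (mF N) (cmeasurableB mf (mF N))) _.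
rewrite -EFinD (_ : 2 * A + e = 2 * (A + e / 2)); last by field.
rewrite EFinM lee_wpmul2l ?lee_fin // EFinD leeD // sqint_distC.
exact: HN.
Qed.

Lemma mean_square_limit_unique F f g : (forall j, cmeasurable D (F j)) ->
  cmeasurable D f -> cmeasurable D g ->
  mean_square_limit F f -> mean_square_limit F g -> ae_eq mu D f g.
Proof.
move=> mF mf mg Ff Fg.
have mfg := cmeasurableB mf mg.
have /(ae_eq_integral_abs mu mD (measurable_cabs2 mfg)) :
    (\int[mu]_(x in D) `|(cabs (f x - g x) ^+ 2)%:E| = 0)%E.
  transitivity (sqint mu D (fun x => f x - g x)).
    by apply: eq_integral => x _; rewrite gee0_abs // lee_fin sqr_ge0.
  apply/eqP; rewrite eq_le sqint_ge0 andbT; apply/lee_addgt0Pr => e e0; rewrite add0e.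
  have e4 : 0 < e / 4 by rewrite divr_gt0.
  have [N HN] := Ff _ e4; have [N' HN'] := Fg _ e4; pose p := maxn N N'.
  rewrite (@eq_sqint _ _ _ mu D _ (fun x => (f x - F p x) + (F p x - g x))); last first.
    by move=> x _; rewrite addrA subrK.
  apply: le_trans (sqintD mu mD (cmeasurableB mf (mF p)) (cmeasurableB (mF p) mg)) _.
  rewrite (_ : e = 2 * (e / 4 + e / 4)); last by field.
  rewrite EFinM lee_wpmul2l ?lee_fin // EFinD leeD //.
    by rewrite sqint_distC HN // leq_maxl.
  by rewrite HN' // leq_maxr.
apply: filterS => x h Dx; have := h Dx => -[/eqP]; rewrite sqrf_eq0 => /eqP/cabs_eq0 h1.
by apply/eqP; rewrite -subr_eq0 h1.
Qed.

Lemma mean_square_limit_lin (z : R[i]) F G f g :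
  (forall j, cmeasurable D (F j)) -> (forall j, cmeasurable D (G j)) ->
  cmeasurable D f -> cmeasurable D g ->
  mean_square_limit F f -> mean_square_limit G g ->
  mean_square_limit (fun j x => z * F j x + G j x) (fun x => z * f x + g x).
Proof.
move=> mF mG mf mg Ff Gg e e0.
pose c := cabs z ^+ 2 + 1; have c0 : 0 < c by rewrite ltr_wpDl ?sqr_ge0.
have [N HN] := Ff (e / 4 / c) (divr_gt0 (divr_gt0 e0 (ltr0n _ 4)) c0).
have [N' HN'] := Gg (e / 4) (divr_gt0 e0 (ltr0n _ 4)).
exists (maxn N N') => p; rewrite geq_max => /andP[/HN Np /HN' Np'].
rewrite (@eq_sqint _ _ _ mu D _ (fun x => z * (F p x - f x) + (G p x - g x))); last first.
  by move=> x _; ring.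
have m1 := cmeasurableB (mF p) mf; have m2 := cmeasurableB (mG p) mg.
apply: le_trans (sqintD mu mD (cmeasurableZ z m1) m2) _.
rewrite (_ : e = 2 * (e / 4 + e / 4)); last by field.
rewrite [leRHS]EFinM lee_wpmul2l ?lee_fin // [leRHS]EFinD leeD //.
apply: le_trans (@sqint_mul _ _ _ mu D (cabs z) _ _ mD (cmeasurableZ z m1) m1 (cabs_ge0 z) _) _.
  by move=> x _; rewrite cabsM.
apply: (@le_trans _ _ ((cabs z ^+ 2)%:E * (e / 4 / c)%:E)%E).
  by rewrite lee_wpmul2l // lee_fin sqr_ge0.
rewrite -EFinM lee_fin.
have -> : cabs z ^+ 2 * (e / 4 / c) = e / 4 * (cabs z ^+ 2 / c) by ring.
rewrite ler_piMr //; first by rewrite divr_ge0 // ltW.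
by rewrite ler_pdivrMr // mul1r lerDl.
Qed.

Lemma ccvgP (r i : R^nat) : cvgn r -> cvgn i ->
  forall z : nat -> R[i], (forall j, complex.Re (z j) = r j) ->
  (forall j, complex.Im (z j) = i j) ->
  ccvg z (limn r +i* limn i)%C.
Proof.
move=> cr ci z zr zi; split=> /=.
  by rewrite (_ : (fun j => _) = r) //; apply/funext.
by rewrite (_ : (fun j => _) = i) //; apply/funext.
Qed.

(** Riesz-Fischer: along a subsequence with rapidly decreasing gaps the
    increments are almost everywhere summable, and Fatou's lemma identifies the
    pointwise limit as the mean-square limit of the whole sequence. *)
Lemma mean_square_complete F : (forall j, cmeasurable D (F j)) ->
  (forall e : R, 0 < e -> exists N, forall p q, (N <= p)%N -> (N <= q)%N ->
    (sqint mu D (fun x => F p x - F q x)%R <= e%:E)%E) ->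
  exists2 g, cmeasurable D g & mean_square_limit F g.
Proof.
move=> mF cauchy.
have /choice[phi Hphi] : forall j : nat, exists N, forall p q, (N <= p)%N -> (N <= q)%N ->
    (sqint mu D (fun x => F p x - F q x)%R <= (4 ^- j)%:E)%E.
  by move=> j; apply: cauchy; rewrite invr_gt0 exprn_gt0.
pose psi j := (j + \sum_(0 <= i < j.+1) phi i)%N.
have psi_ge i j : (i <= j)%N -> (phi i <= psi j)%N.
  move=> ij; rewrite /psi (bigD1_seq i) ?iota_uniq ?mem_index_iota //=.
  by rewrite addnCA leq_addr.
pose G j := F (psi j).
have mG j : cmeasurable D (G j) by exact: mF.
pose inc j x : \bar R := (2 ^+ j * cabs (G j.+1 x - G j x) ^+ 2)%:E.
have inc0 j x : (0 <= inc j x)%E by rewrite lee_fin mulr_ge0 ?sqr_ge0.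
have minc j : measurable_fun D (inc j).
  rewrite /inc; under eq_fun do rewrite EFinM.
  by apply: measurable_funeM; apply/measurable_cabs2/cmeasurableB.
have iinc : (\int[mu]_(x in D) \sum_(0 <= j <oo) inc j x < +oo)%E.
  rewrite integral_nneseries //; apply: (@le_lt_trans _ _ (2%:E)); last exact: ltry.
  apply: lime_le.
    apply: is_cvg_nneseries => j _ _; exact: integral_ge0.
  apply: nearW => N.
  apply: (@le_trans _ _ (\sum_(0 <= j < N) (1 * 2^-1 ^+ j)%:E)%E).
    apply: lee_sum => j _; rewrite /inc; under eq_integral do rewrite EFinM.
    rewrite ge0_integralZl_EFin //; last 2 first.
    - by move=> x _; rewrite lee_fin sqr_ge0.
    - by apply/measurable_cabs2/cmeasurableB.
    apply: (@le_trans _ _ ((2 ^+ j)%:E * (4 ^- j)%:E)%E).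
      rewrite lee_wpmul2l ?lee_fin //; apply: Hphi; exact: psi_ge.
    rewrite -EFinM lee_fin mul1r (_ : 4 = 2 * 2) ?exprMn ?invfM; last by ring.
    by rewrite mulrA mulfV ?mul1r ?exprVn // expf_neq0.
  rewrite sumEFin lee_fin; apply: le_trans (@geometric_le_lim R N 1 2^-1 _ _ _) _ => //.
  - by rewrite ger0_norm // invf_lt1 // ltr1n.
  by rewrite mul1r (_ : 1 - 2^-1 = 2^-1 :> R) ?invrK //; field.
have cG : {ae mu, forall x, D x -> exists l, ccvg (G^~ x) l}.
  have : mu.-integrable D (fun x => \sum_(0 <= j <oo) inc j x)%E.
    apply/integrableP; split.
      by apply: ge0_emeasurable_sum.
    rewrite (eq_integral (fun x => \sum_(0 <= j <oo) inc j x)%E) // => x _.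
    by rewrite gee0_abs // nneseries_ge0.
  move=> /(integrable_ae mD); apply: filterS => x finx Dx.
  have {}finx := finx Dx.
  set S := (\sum_(0 <= j <oo) inc j x)%E in finx.
  have incS N : \sum_(0 <= j < N) 2 ^+ j * cabs (G j.+1 x - G j x) ^+ 2 <= fine S.
    rewrite -lee_fin fineK // -sumEFin; apply: nneseries_lim_ge => j _ _; exact: inc0.
  have bv N : \sum_(0 <= j < N) cabs (G j.+1 x - G j x) <= 2 + fine S.
    apply: (@le_trans _ _ (\sum_(0 <= j < N)
        (1 * 2^-1 ^+ j + 2 ^+ j * cabs (G j.+1 x - G j x) ^+ 2))).
      apply: ler_sum => j _; set t := cabs _; set q := 2^-1 ^+ j.
      have q0 : 0 < q by rewrite exprn_gt0 // invr_gt0.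
      have -> : 2 ^+ j = q^-1 :> R by rewrite /q exprVn invrK.
      rewrite mul1r -(ler_pM2l q0) mulrDr mulrA mulfV ?lt0r_neq0 // mul1r.
      have := sqr_ge0 (q - t); have : 0 <= t by exact: cabs_ge0.
      nra.
    rewrite big_split lerD //=; apply: le_trans (@geometric_le_lim R N 1 2^-1 _ _ _) _ => //.
    - by rewrite ger0_norm // invf_lt1 // ltr1n.
    by rewrite mul1r (_ : 1 - 2^-1 = 2^-1 :> R) ?invrK //; field.
  have cr : cvgn (fun j => complex.Re (G j x)).
    apply: (@bounded_variation_cvg _ _ (2 + fine S)) => N; apply: le_trans (bv N).
    apply: ler_sum => j _; rewrite -raddfB; exact: Re_le_cabs.
  have ci : cvgn (fun j => complex.Im (G j x)).
    apply: (@bounded_variation_cvg _ _ (2 + fine S)) => N; apply: le_trans (bv N).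
    apply: ler_sum => j _; rewrite -raddfB; exact: Im_le_cabs.
  by exists (limn (fun j => complex.Re (G j x)) +i* limn (fun j => complex.Im (G j x)))%C.
pose g x := (fine (limn_esup (fun j => (complex.Re (G j x))%:E)) +i*
             fine (limn_esup (fun j => (complex.Im (G j x))%:E)))%C.
have mg : cmeasurable D g.
  split; apply: measurableT_comp (measurable_fun_limn_esup _) => // j;
    by apply/measurable_EFinP; have [] := mG j.
have Gg : {ae mu, forall x, D x -> ccvg (G^~ x) (g x)}.
  apply: filterS cG => x cx Dx; have [l [lr li]] := cx Dx.
  suff -> : g x = l by split.
  have Er : limn_esup (fun j => (complex.Re (G j x))%:E) = (complex.Re l)%:E.
    by apply: (cvg_limn_einf_sup _).2; exact: cvgn_EFin.
  have Ei : limn_esup (fun j => (complex.Im (G j x))%:E) = (complex.Im l)%:E.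
    by apply: (cvg_limn_einf_sup _).2; exact: cvgn_EFin.
  by rewrite /g Er Ei; case: (l).
exists g => // e e0; have [N HN] := cauchy e e0.
exists N => p Np; apply: (@sqint_fatou G (F p) g N) => // j Nj.
by apply: HN => //; apply: leq_trans Nj (leq_addr _ _).
Qed.

End MeanSquareLimits.

(** * Unconditional sums over a countable set *)

Section UnconditionalSums.
Variables (R : realType) (Xi : choiceType) (I : set Xi).
Local Open Scope fset_scope.

Lemma sum_fsetD (V : zmodType) (F : Xi -> V) (A B : {fset Xi}) : A `<=` B ->
  (\sum_(xi <- B) F xi = \sum_(xi <- A) F xi + \sum_(xi <- B `\` A) F xi)%R.
Proof.
move=> AB; rewrite (big_fsetID _ (mem A)) /=.
rewrite (_ : [fset x in B | x \in A] = A); last first.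
  apply/fsetP => x; rewrite !inE /=.
  by case xA : (x \in A); rewrite ?andbF // andbT (fsubsetP AB).
rewrite (_ : [fset x in B | x \notin A] = B `\` A) //.
by apply/fsetP => x; rewrite !inE /= andbC.
Qed.

(** An increasing sequence of finite sets exhausting [I] turns sums over all
    finite subsets into sequential limits. *)
Variable E : nat -> {fset Xi}.
Hypothesis E_sub : forall N, ([set` E N] `<=` I)%classic.
Hypothesis E_mono : forall p q, (p <= q)%N -> E p `<=` E q.
Hypothesis E_exh : forall s : {fset Xi}, ([set` s] `<=` I)%classic ->
  exists N, s `<=` E N.

Lemma E_I N xi : xi \in E N -> I xi.
Proof. exact: E_sub. Qed.

Section NonnegTerms.
Variables (w : Xi -> R) (S : R).
Hypothesis w_ge0 : forall xi, I xi -> (0 <= w xi)%R.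
Hypothesis w_le : forall N, (\sum_(xi <- E N) w xi <= S)%R.

Let sumw_ge0 (A : {fset Xi}) : ([set` A] `<=` I)%classic -> (0 <= \sum_(xi <- A) w xi)%R.
Proof. by move=> AI; rewrite big_seq sumr_ge0 // => xi /AI; exact: w_ge0. Qed.

Let P N := (\sum_(xi <- E N) w xi)%R.

Let P_nd : nondecreasing_seq P.
Proof.
move=> p q pq; rewrite /P (sum_fsetD _ (E_mono pq)) lerDl sumw_ge0 // => x /=.
by rewrite !inE => /andP[_]; exact: E_I.
Qed.

Lemma cvg_sum_exhaustion : cvgn P.
Proof.
by apply: nondecreasing_is_cvgn => //; exists S => _ [N _ <-]; exact: w_le.
Qed.

(** Choose [N] such that the sum over [E N] is within [e] of the supremum of these
    sums; a set disjoint from [E N] cannot add more than [e]. *)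
Lemma summable_tail (e : R) : (0 < e)%R -> exists N, forall s : {fset Xi},
  ([set` s] `<=` I)%classic -> [disjoint s & E N] -> (\sum_(xi <- s) w xi <= e)%R.
Proof.
move=> e0; have supP : has_sup (range P).
  by split; [exists (P 0%N), 0%N|exists S => _ [N _ <-]; exact: w_le].
have [_ [N _ <-] HN] := sup_adherent e0 supP.
exists N => s sI dis.
have sEI : ([set` (s `|` E N)%fset] `<=` I)%classic.
  by move=> x /=; rewrite inE => /orP[/sI//|]; exact: E_I.
have [M HM] := E_exh sEI.
have PM : (P M <= sup (range P))%R by apply: sup_upper_bound => //; exists M.
have : (\sum_(xi <- s `|` E N) w xi <= P M)%R.
  rewrite /P (sum_fsetD _ HM) lerDl sumw_ge0 // => x /=.
  by rewrite in_fsetD => /andP[_]; exact: E_I.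
rewrite (sum_fsetD _ (fsubsetUr s (E N))).
have -> : (s `|` E N) `\` E N = s.
  apply/fsetP => x; rewrite !inE; case xE : (x \in E N) => //=; last by rewrite orbF.
  apply/esym/negbTE; apply/negP => xs.
  by move/fdisjointP: dis => /(_ x xs); rewrite xE.
rewrite -/(P N); lra.
Qed.

End NonnegTerms.

(** The limit along the exhaustion exists by absolute convergence, and the small
    tails of [w] show that it does not depend on the exhaustion. *)
Lemma has_sum_exhaustion (w : Xi -> R) (t : Xi -> R[i]) (S : R) :
  (forall xi, I xi -> (cabs (t xi) <= w xi)%R) ->
  (forall N, (\sum_(xi <- E N) w xi <= S)%R) ->
  exists2 z, has_sum I t z & ccvg (fun N => \sum_(xi <- E N) t xi)%R z.
Proof.
move=> tw wS.
have w0 xi : I xi -> (0 <= w xi)%R by move=> /tw; apply: le_trans; exact: cabs_ge0.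
have cw := cvg_sum_exhaustion w0 wS.
have sum_le (A : {fset Xi}) : ([set` A] `<=` I)%classic ->
    (cabs (\sum_(xi <- A) t xi) <= \sum_(xi <- A) w xi)%R.
  move=> AI; apply: le_trans (cabs_sum_le _ _ _) _.
  by rewrite big_seq [leRHS]big_seq; apply: ler_sum => xi /AI; exact: tw.
have creal (h : Xi -> R) : (forall xi, I xi -> (`|h xi| <= w xi)%R) ->
    cvgn (fun N => \sum_(xi <- E N) h xi)%R.
  move=> hw.
  have c2 : cvgn (fun N => \sum_(xi <- E N) (w xi + h xi))%R.
    apply: (@cvg_sum_exhaustion _ (S + S)%R) => [xi Ixi|N].
      by have := hw xi Ixi; rewrite ler_norml => /andP[h1 _]; lra.
    apply: (@le_trans _ _ (\sum_(xi <- E N) (w xi + w xi))%R).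
      rewrite big_seq [leRHS]big_seq; apply: ler_sum => xi /E_I /hw.
      by rewrite lerD2l; apply: le_trans; exact: ler_norm.
    by rewrite big_split lerD.
  rewrite (_ : (fun N => _) = (fun N => \sum_(xi <- E N) (w xi + h xi) -
      \sum_(xi <- E N) w xi)%R); first exact: is_cvgB.
  by apply/funext => N; rewrite big_split /= addrAC subrr add0r.
have cr := creal (fun xi => complex.Re (t xi))
  (fun xi Ixi => le_trans (Re_le_cabs (t xi)) (tw xi Ixi)).
have ci := creal (fun xi => complex.Im (t xi))
  (fun xi Ixi => le_trans (Im_le_cabs (t xi)) (tw xi Ixi)).
pose z : R[i] := (limn (fun N => \sum_(xi <- E N) complex.Re (t xi))%R +i*
           limn (fun N => \sum_(xi <- E N) complex.Im (t xi))%R)%C.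
have cz : ccvg (fun N => \sum_(xi <- E N) t xi)%R z.
  by apply: ccvgP => // N; rewrite raddf_sum.
exists z => // eps eps0.
have e40 : (0 < eps / 4)%R by rewrite divr_gt0.
have [N HN] := summable_tail w0 wS e40.
have [M NM HM] : exists2 M, (N <= M)%N & (cabs (\sum_(xi <- E M) t xi - z) < eps / 4)%R.
  have := @ccvgB_cabs2 _ _ _ z cz; rewrite subrr cabs0 expr0n /= => /cvgrPdist_lt.
  move=> /(_ ((eps / 4) ^+ 2)%R); rewrite exprn_gt0 // => /(_ isT)[M _ HM].
  exists (maxn N M); first exact: leq_maxl.
  have := HM (maxn N M) (leq_maxr _ _).
  rewrite sub0r normrN ger0_norm ?sqr_ge0 // ltr_sqr ?nnegrE ?cabs_ge0 ?ltW //.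
  by rewrite -cabsN opprB.
have diff (A : {fset Xi}) : E N `<=` A -> ([set` A] `<=` I)%classic ->
    (cabs (\sum_(xi <- A) t xi - \sum_(xi <- E N) t xi) <= eps / 4)%R.
  move=> NA AI; rewrite (sum_fsetD _ NA) addrAC subrr add0r.
  have AEI : ([set` (A `\` E N)%fset] `<=` I)%classic.
    by move=> x /=; rewrite in_fsetD => /andP[_ /AI].
  by apply: le_trans (sum_le _ AEI) (HN _ AEI _); apply/fdisjointP => x;
    rewrite in_fsetD => /andP[].
exists (E N); first exact: E_sub.
move=> s Ns sI.
have Ns' : E N `<=` s by apply/fsubsetP => x; exact: Ns.
have -> : (\sum_(xi <- s) t xi - z = (\sum_(xi <- s) t xi - \sum_(xi <- E N) t xi) -
    (\sum_(xi <- E M) t xi - \sum_(xi <- E N) t xi) + (\sum_(xi <- E M) t xi - z))%R.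
  by ring.
apply: le_lt_trans (cabsD_le _ _) _.
have h1 := diff _ Ns' sI; have h2 := diff _ (E_mono NM) (@E_sub M).
have := cabsB_le (\sum_(xi <- s) t xi - \sum_(xi <- E N) t xi)%R
  (\sum_(xi <- E M) t xi - \sum_(xi <- E N) t xi)%R.
lra.
Qed.

End UnconditionalSums.

(** The sharp inverse [pickle_inv] decodes nothing but genuine codes, so every
    element appears exactly when its own code is reached. *)
Definition code_exhaustion (Xi : countType) (I : set Xi) (N : nat) : {fset Xi} :=
  [fset x in pmap (@choice.pickle_inv Xi) (iota 0 N) | x \in I]%fset.

Section CodeExhaustion.
Variables (Xi : countType) (I : set Xi).
Local Open Scope fset_scope.

Lemma in_code_exhaustion N x :
  (x \in code_exhaustion I N) = (choice.pickle x < N)%N && (x \in I).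
Proof.
rewrite !inE /=; congr (_ && _); rewrite mem_pmap; apply/mapP/idP.
  move=> [m]; rewrite mem_iota /= add0n => mN /esym xm.
  have := @choice.pickle_invK Xi m; rewrite xm /= => ->.
  exact: mN.
by move=> xN; exists (choice.pickle x); rewrite ?mem_iota // choice.pickleK_inv.
Qed.

Lemma code_exhaustion_sub N : ([set` code_exhaustion I N] `<=` I)%classic.
Proof. by move=> x /=; rewrite in_code_exhaustion => /andP[_ /set_mem]. Qed.

Lemma code_exhaustion_mono p q : (p <= q)%N -> code_exhaustion I p `<=` code_exhaustion I q.
Proof.
move=> pq; apply/fsubsetP => x; rewrite !in_code_exhaustion => /andP[xp ->].
by rewrite (leq_trans xp).
Qed.

Lemma code_exhaustion_exh (s : {fset Xi}) : ([set` s] `<=` I)%classic ->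
  exists N, s `<=` code_exhaustion I N.
Proof.
move=> sI; exists (\max_(x <- s) choice.pickle x).+1; apply/fsubsetP => x xs.
rewrite in_code_exhaustion ltnS (mem_set (sI _ xs)) andbT.
by apply: leq_bigmax_seq.
Qed.

End CodeExhaustion.

(** * The inner product of L^2 and the Bessel inequality *)

Section L2Space.
Variables (R : realType) (n : nat) (Omega : set 'rV[R]_n).
Hypothesis mOmega : measurable Omega.
Local Notation X := 'rV[R]_n.
Local Notation mu := (lebesgue_rV R n).
Implicit Types f g h : X -> R[i].

Lemma L2P f : L2 Omega f <-> cmeasurable Omega f /\ (sqint mu Omega f < +oo)%E.
Proof. by split=> [[]|[[]]]. Qed.

Lemma L2_cmeasurable f : L2 Omega f -> cmeasurable Omega f.
Proof. by case/L2P. Qed.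

Lemma sqint_L2norm f : L2 Omega f -> sqint mu Omega f = (L2norm Omega f ^+ 2)%:E.
Proof.
move=> /L2P[_ ff]; have sf := sqint_ge0 mu Omega f.
rewrite /L2norm sqr_sqrtr; last by rewrite fine_ge0.
by rewrite /Rintegral fineK // ge0_fin_numE.
Qed.

Lemma L2_lin (z : R[i]) f g : L2 Omega f -> L2 Omega g ->
  L2 Omega (fun x => z * f x + g x).
Proof.
move=> /L2P[mf lf] /L2P[mg lg]; have mzf := cmeasurableZ z mf.
apply/L2P; split; first exact: cmeasurableD.
apply: le_lt_trans (sqintD mu mOmega mzf mg) _.
rewrite lte_mul_pinfty ?lee_fin // lte_add_pinfty //.
apply: le_lt_trans (@sqint_mul _ _ _ mu _ (cabs z) _ _ mOmega mzf mf (cabs_ge0 z) _) _.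
  by move=> x _; rewrite cabsM.
by rewrite lte_mul_pinfty ?lee_fin ?sqr_ge0.
Qed.

Lemma L2_0 : L2 Omega (fun=> 0).
Proof.
apply/L2P; split; first exact: cmeasurable_cst.
rewrite /sqint (eq_integral (fun=> 0%E)) ?integral0 ?ltry // => x _.
by rewrite cabs0 expr0n.
Qed.

Lemma L2_sum (Xi : eqType) (e : Xi -> X -> R[i]) (s : seq Xi) (c : Xi -> R[i]) :
  (forall xi, xi \in s -> L2 Omega (e xi)) ->
  L2 Omega (fun x => \sum_(xi <- s) c xi * e xi x).
Proof.
elim: s => [|xi l IH] He.
  by under eq_fun do rewrite big_nil; exact: L2_0.
under eq_fun do rewrite big_cons; apply: L2_lin; first by apply: He; rewrite mem_head.
by apply: IH => eta el; apply: He; rewrite inE el orbT.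
Qed.

Lemma integrable_cabs2 f : L2 Omega f ->
  mu.-integrable Omega (EFin \o (fun x => cabs (f x) ^+ 2)).
Proof.
move=> /L2P[mf lf]; apply/integrableP; split; first exact: measurable_cabs2.
under eq_integral do rewrite gee0_abs ?lee_fin ?sqr_ge0 //.
exact: lf.
Qed.

Lemma cabs_mul_le (z w : R[i]) : cabs (z * w^*%C) <= cabs z ^+ 2 + cabs w ^+ 2.
Proof.
rewrite cabsM cabsJ; have := sqr_ge0 (cabs z - cabs w).
have := cabs_ge0 z; have := cabs_ge0 w; nra.
Qed.

Lemma integrable_product f g : L2 Omega f -> L2 Omega g ->
  mu.-integrable Omega (EFin \o (fun x => complex.Re (f x * (g x)^*%C))) /\
  mu.-integrable Omega (EFin \o (fun x => complex.Im (f x * (g x)^*%C))).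
Proof.
move=> lf lg; have [mf _] := (L2P f).1 lf; have [mg _] := (L2P g).1 lg.
have [mr mi] := cmeasurableM mf (cmeasurableJ mg).
have ifg := integrableD mOmega (integrable_cabs2 lf) (integrable_cabs2 lg).
split; apply: le_integrable ifg => //; try exact/measurable_EFinP.
- move=> x _ /=; rewrite lee_fin [leRHS]ger0_norm ?addr_ge0 ?sqr_ge0 //.
  exact: le_trans (Re_le_cabs _) (cabs_mul_le _ _).
- move=> x _ /=; rewrite lee_fin [leRHS]ger0_norm ?addr_ge0 ?sqr_ge0 //.
  exact: le_trans (Im_le_cabs _) (cabs_mul_le _ _).
Qed.

Lemma L2inner_ae f f' g g' : L2 Omega f -> L2 Omega f' -> L2 Omega g -> L2 Omega g' ->
  eqae Omega f f' -> eqae Omega g g' -> L2inner Omega f g = L2inner Omega f' g'.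
Proof.
move=> lf lf' lg lg' ff gg.
have [/measurable_int mr /measurable_int mi] := integrable_product lf lg.
have [/measurable_int mr' /measurable_int mi'] := integrable_product lf' lg'.
rewrite /L2inner /cintegral /Rintegral; congr (fine _ +i* fine _)%C.
  by apply: ae_eq_integral => //; apply: filterS2 ff gg => x fx gx Ox; rewrite fx // gx.
by apply: ae_eq_integral => //; apply: filterS2 ff gg => x fx gx Ox; rewrite fx // gx.
Qed.

Lemma L2inner_lin (z : R[i]) f g h : L2 Omega f -> L2 Omega g -> L2 Omega h ->
  L2inner Omega (fun x => z * f x + g x) h = z * L2inner Omega f h + L2inner Omega g h.
Proof.
move=> lf lg lh.
have [fr fi] := integrable_product lf lh; have [gr gi] := integrable_product lg lh.
rewrite /L2inner /cintegral; case: z => a b.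
have iZ (c : R) (F : X -> R) : mu.-integrable Omega (EFin \o F) ->
    mu.-integrable Omega (EFin \o (fun x => c * F x)).
  by move=> iF; exact (integrableZl mOmega c iF).
apply/eqP; rewrite eq_complex /=; apply/andP; split; apply/eqP.
  rewrite (@eq_Rintegral _ _ _ mu Omega (fun x => (a * complex.Re (f x * (h x)^*%C) +
      (- b) * complex.Im (f x * (h x)^*%C)) + complex.Re (g x * (h x)^*%C))).
    rewrite !RintegralD // ?RintegralZl ?mulNr //; try exact: iZ.
    by exact (integrableD mOmega (iZ a _ fr) (iZ (- b) _ fi)).
  by move=> x _ /=; case: (f x) (g x) (h x) => ? ? [? ?] [? ?] /=; ring.
rewrite (@eq_Rintegral _ _ _ mu Omega (fun x => (a * complex.Im (f x * (h x)^*%C) +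
    b * complex.Re (f x * (h x)^*%C)) + complex.Im (g x * (h x)^*%C))).
  rewrite !RintegralD // ?RintegralZl //; try exact: iZ.
  by exact (integrableD mOmega (iZ a _ fi) (iZ b _ fr)).
by move=> x _ /=; case: (f x) (g x) (h x) => ? ? [? ?] [? ?] /=; ring.
Qed.

Lemma L2inner_conj f g : L2 Omega f -> L2 Omega g ->
  L2inner Omega f g = (L2inner Omega g f)^*%C.
Proof.
move=> lf lg; have [gr gi] := integrable_product lg lf.
rewrite /L2inner /cintegral; apply/eqP; rewrite eq_complex /=; apply/andP; split; apply/eqP.
  by apply: eq_Rintegral => x _; case: (f x) (g x) => ? ? [? ?] /=; ring.
rewrite (@eq_Rintegral _ _ _ mu Omega (fun x => (-1) * complex.Im (g x * (f x)^*%C))).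
  by rewrite RintegralZl // mulN1r.
by move=> x _; case: (f x) (g x) => ? ? [? ?] /=; ring.
Qed.

Lemma L2inner_sum (Xi : eqType) (e : Xi -> X -> R[i]) (s : seq Xi) (c : Xi -> R[i]) g :
  (forall xi, xi \in s -> L2 Omega (e xi)) -> L2 Omega g ->
  L2inner Omega (fun x => \sum_(xi <- s) c xi * e xi x) g =
  \sum_(xi <- s) c xi * L2inner Omega (e xi) g.
Proof.
move=> He lg; elim: s He => [|xi l IH] He.
  rewrite big_nil; under eq_fun do rewrite big_nil.
  transitivity (-1 * L2inner Omega (fun=> 0) g + L2inner Omega (fun=> 0) g); last first.
    by rewrite mulN1r addNr.
  rewrite -(L2inner_lin (-1) L2_0 L2_0 lg).
  by congr (L2inner _ _ _); apply/funext => x; rewrite mulr0 addr0.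
have Hl eta : eta \in l -> L2 Omega (e eta).
  by move=> el; apply: He; rewrite inE el orbT.
rewrite big_cons -IH //; under eq_fun do rewrite big_cons.
by apply: L2inner_lin; [apply: He; rewrite mem_head|exact: L2_sum|].
Qed.

(** A weighted form of the Cauchy-Schwarz inequality. *)
Lemma Re_L2inner_le (t : R) f g : 0 < t -> L2 Omega f -> L2 Omega g ->
  complex.Re (L2inner Omega f g) <=
    (t * L2norm Omega f ^+ 2 + t^-1 * L2norm Omega g ^+ 2) / 2.
Proof.
move=> t0 lf lg; have [fgr _] := integrable_product lf lg.
have norm2 h : L2 Omega h -> L2norm Omega h ^+ 2 = \int[mu]_(x in Omega) (cabs (h x) ^+ 2).
  by move=> lh; rewrite /L2norm sqr_sqrtr // fine_ge0 // sqint_ge0.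
have iZ (c : R) (F : X -> R) : mu.-integrable Omega (EFin \o F) ->
    mu.-integrable Omega (EFin \o (fun x => c * F x)).
  by move=> iF; exact (integrableZl mOmega c iF).
have i1 := iZ (t / 2) _ (integrable_cabs2 lf).
have i2 := iZ (t^-1 / 2) _ (integrable_cabs2 lg).
have -> : (t * L2norm Omega f ^+ 2 + t^-1 * L2norm Omega g ^+ 2) / 2 =
    \int[mu]_(x in Omega) (t / 2 * cabs (f x) ^+ 2 + t^-1 / 2 * cabs (g x) ^+ 2).
  rewrite RintegralD // RintegralZl //; last exact: integrable_cabs2.
  by rewrite RintegralZl ?norm2 //; [field; exact: lt0r_neq0|exact: integrable_cabs2].
apply: le_Rintegral => //; first by exact (integrableD mOmega i1 i2).
move=> x _; apply: le_trans (ler_norm _) _; apply: le_trans (Re_le_cabs _) _.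
rewrite cabsM cabsJ; have tt : t * t^-1 = 1 by rewrite mulfV // lt0r_neq0.
rewrite -subr_ge0 (_ : _ - _ = t / 2 * (cabs (f x) - t^-1 * cabs (g x)) ^+ 2).
  by rewrite mulr_ge0 ?sqr_ge0 // divr_ge0 // ltW.
by field; exact: lt0r_neq0.
Qed.

(** Bessel's inequality for the coefficients against a Riesz basis, by duality
    with the upper bound for its finite combinations. *)
Lemma bessel (Xi : choiceType) (e : Xi -> X -> R[i]) (s : {fset Xi}) (beta : R) f :
  0 < beta -> (forall xi, xi \in s -> L2 Omega (e xi)) ->
  (forall c : Xi -> R[i], L2norm Omega (finite_comb e s c) ^+ 2
    <= beta * (\sum_(xi <- s) cabs (c xi) ^+ 2)) ->
  L2 Omega f ->
  \sum_(xi <- s) cabs (L2inner Omega f (e xi)) ^+ 2 <= beta * L2norm Omega f ^+ 2.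
Proof.
move=> b0 He Hs lf; pose c xi := L2inner Omega f (e xi).
set S := \sum_(xi <- s) _.
have lV := L2_sum c He.
have E : L2inner Omega f (finite_comb e s c) = S%:C%C.
  rewrite L2inner_conj // L2inner_sum // raddf_sum /S rmorph_sum.
  rewrite big_seq [RHS]big_seq; apply: eq_bigr => xi sxi.
  rewrite -/(c xi) (_ : L2inner Omega (e xi) f = (c xi)^*%C); last first.
    by apply: L2inner_conj => //; exact: He.
  by case: (c xi) => a b; apply/eqP; rewrite eq_complex cabs2 /=; apply/andP;
    split; apply/eqP; ring.
have := Re_L2inner_le b0 lf lV; rewrite E /=.
have := Hs c; rewrite -/S => h1 h2.
have : beta^-1 * L2norm Omega (finite_comb e s c) ^+ 2 <= S by rewrite ler_pdivrMl.
lra.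
Qed.

End L2Space.

(** * Decay of coefficients and almost everywhere summability *)

Section CoefficientDecay.
Variables (R : realType) (n m K : nat) (Omega : set 'rV[R]_n) (L : operator R n).
Hypothesis mOmega : measurable Omega.
Hypothesis m_gt0 : (0 < m)%N.
Hypothesis L_linear : linear_operator Omega L.
Local Notation X := 'rV[R]_n.

(** The adjoint moves [L] to [e]; its eigenvalue is conjugated a second time by
    the antilinearity of the inner product in the second argument. *)
Lemma L2inner_eigen (g e : X -> R[i]) (z : R[i]) : op_dom L g -> L2 Omega e ->
  op_dom (adjoint Omega L) e -> eqae Omega (adjoint Omega L e) (fun x => z^*%C * e x) ->
  L2inner Omega (L g) e = z * L2inner Omega g e.
Proof.
move=> dg le [_ ex] ae; have [domL2 imL2 _ _ _] := L_linear.
have lg := domL2 _ dg.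
have [lh Hh] := xgetPex (fun=> 0) ex.
have lze : L2 Omega (fun x => z^*%C * e x).
  have := L2_lin mOmega (z^*%C) le (L2_0 Omega).
  by congr (L2 Omega _); apply/funext => x; rewrite addr0.
rewrite Hh // (L2inner_ae mOmega lg lg lh lze) //; last by apply: aeW.
rewrite L2inner_conj // [in RHS]L2inner_conj //.
have := @L2inner_sum _ _ Omega mOmega unit (fun=> e) [:: tt] (fun=> z^*%C) g
  (fun _ _ => le) lg.
rewrite big_seq1; under eq_fun do rewrite big_seq1; move=> ->.
by case: z {ae lze} (L2inner _ _ _) => a b [c d]; apply/eqP; rewrite eq_complex /=;
  apply/andP; split; apply/eqP; ring.
Qed.

Lemma L2inner_eigen_iter (f e : X -> R[i]) (z : R[i]) j : Cinfty Omega L f -> L2 Omega e ->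
  op_dom (adjoint Omega L) e -> eqae Omega (adjoint Omega L e) (fun x => z^*%C * e x) ->
  L2inner Omega (iter j L f) e = z ^+ j * L2inner Omega f e.
Proof.
move=> [_ df] le de ae; elim: j => [|j IH]; first by rewrite mul1r.
by rewrite iterS (L2inner_eigen _ le de ae) // IH exprS mulrA.
Qed.

Lemma powR_japanese_le (a s0 : R) (p : nat) : 0 <= a -> s0 <= p%:R ->
  (1 + a ^+ 2) `^ ((2 * m)%:R^-1) `^ s0 <= 2 ^+ p * (1 + a ^+ (2 * p)).
Proof.
move=> a0 sp; have a2 : 0 <= a ^+ 2 by exact: sqr_ge0.
have b1 : 1 <= 1 + a ^+ 2 by rewrite lerDl.
rewrite -powRrM; apply: (@le_trans _ _ ((1 + a ^+ 2) ^+ p)).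
  rewrite -[leRHS]powR_mulrn ?addr_ge0 //; apply: ler_powR => //.
  case: (leP 0 s0) => [s00|/ltW s00].
    apply: le_trans sp; rewrite mulrC ler_piMr // invf_le1 ?ler1n ?ltr0n ?muln_gt0 //.
  by apply: le_trans (_ : 0 <= _); rewrite ?mulr_ge0_le0 ?invr_ge0.
case: (leP a 1) => a1.
  apply: (@le_trans _ _ (2 ^+ p)).
    rewrite lerXn2r ?nnegrE ?addr_ge0 // (_ : 2 = 1 + 1) // lerD2l.
    by rewrite -[leRHS](expr1n _ 2) lerXn2r ?nnegrE.
  by rewrite ler_peMr ?exprn_ge0 // lerDl exprn_ge0.
apply: (@le_trans _ _ ((2 * a ^+ 2) ^+ p)).
  rewrite lerXn2r ?nnegrE ?addr_ge0 ?mulr_ge0 // mulr_natl mulr2n lerD2r.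
  by rewrite exprn_ege1 // ltW.
by rewrite exprMn -exprM ler_wpM2l ?exprn_ge0 // lerDr.
Qed.

Variables (I : set 'rV[int]_K) (lambda : 'rV[int]_K -> R[i]) (v : 'rV[int]_K -> X -> R[i]).
Hypothesis v_eigen : eigenfunctions Omega I (adjoint Omega L) (fun xi => (lambda xi)^*%C) v.
Variable beta : R.
Hypothesis beta_gt0 : 0 < beta.
Hypothesis v_L2 : forall xi, I xi -> L2 Omega (v xi).
Hypothesis v_riesz : forall (s : {fset 'rV[int]_K}) c, [set` s] `<=` I ->
  L2norm Omega (finite_comb v s c) ^+ 2 <= beta * (\sum_(xi <- s) cabs (c xi) ^+ 2).

(** The coefficients of [L ^ j f] are those of [f] multiplied by
    [lambda ^ j], and all of them are bounded by Bessel's inequality. *)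
Lemma fourier_coeff_decay (f : X -> R[i]) (s0 : R) : Cinfty Omega L f ->
  exists C : R, forall xi, I xi ->
    cabs (fourier_coeff Omega v f xi) <= C * japanese m (lambda xi) `^ (- s0).
Proof.
move=> Cf; pose p := (Num.truncn `|s0|).+1.
have sp : s0 <= p%:R.
  by apply: le_trans (ler_norm _) (ltW _); have /andP[] := truncn_itv (normr_ge0 s0).
have Lf j : L2 Omega (iter j L f).
  by have [domL2 _ _ _ _] := L_linear; case: Cf => _ /(_ j); exact: domL2.
pose C j := Num.sqrt (beta * L2norm Omega (iter j L f) ^+ 2).
have coef j xi : I xi ->
    cabs (lambda xi) ^+ j * cabs (fourier_coeff Omega v f xi) <= C j.
  move=> Ixi; have [dv ev] := v_eigen Ixi.
  have := @bessel _ _ Omega mOmega _ v [fset xi]%fset beta (iter j L f) beta_gt0.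
  rewrite big_seq_fset1 (L2inner_eigen_iter _ Cf (v_L2 Ixi) dv ev) => H.
  rewrite -cabsX -cabsM -ler_sqr ?nnegrE ?cabs_ge0 ?sqrtr_ge0 //.
  rewrite sqr_sqrtr; last by apply: mulr_ge0; [exact: ltW|exact: sqr_ge0].
  apply: H => //.
    by move=> eta; rewrite inE => /eqP ->; exact: v_L2.
  by move=> c; apply: v_riesz => eta /=; rewrite inE => /eqP ->.
exists (2 ^+ p * (C 0%N + C (2 * p)%N)) => xi Ixi.
set c := cabs (fourier_coeff _ _ _ _); set a := cabs (lambda xi).
have c0 : 0 <= c by exact: cabs_ge0.
have J0 : 0 < japanese m (lambda xi) `^ s0.
  by rewrite powR_gt0 // powR_gt0 // ltr_pwDl // sqr_ge0.
rewrite powRN ler_pdivlMr //.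
apply: le_trans (ler_wpM2l c0 (powR_japanese_le (cabs_ge0 _) sp)) _.
rewrite mulrCA ler_wpM2l ?exprn_ge0 // mulrDr mulr1 lerD //.
  by have := coef 0%N xi Ixi; rewrite expr0 mul1r.
by rewrite mulrC; exact: coef.
Qed.

End CoefficientDecay.

Section AlmostEverywhereSummable.
Context d (T : measurableType d) (R : realType) (mu : {measure set T -> \bar R}).
Variables (D : set T) (Xi : choiceType) (I : set Xi) (E : nat -> {fset Xi}).
Hypothesis mD : measurable D.
Hypothesis E_sub : forall N, [set` E N] `<=` I.
Hypothesis E_mono : forall p q, (p <= q)%N -> (E p `<=` E q)%fset.
Variables (c : Xi -> R) (u : Xi -> T -> R[i]) (S : R).
Hypothesis c_ge0 : forall xi, I xi -> 0 <= c xi.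
Hypothesis c_le : forall N, \sum_(xi <- E N) c xi <= S.
Hypothesis u_meas : forall xi, I xi -> cmeasurable D (u xi).
Hypothesis u_norm : forall xi, I xi -> (sqint mu D (u xi) <= 1)%E.

(** The integrals of the partial sums are at most [S]. By Fatou's lemma their lower
    limit, which bounds all of them, is integrable and so finite almost
    everywhere. *)
Lemma ae_summable : {ae mu, forall x, D x ->
  exists B : R, forall N, \sum_(xi <- E N) c xi * cabs (u xi x) ^+ 2 <= B}.
Proof.
pose h xi x : \bar R := if `[< I xi >] then (c xi * cabs (u xi x) ^+ 2)%:E else 0%E.
have h0 xi x : (0 <= h xi x)%E.
  by rewrite /h; case: asboolP => // Ixi; rewrite lee_fin mulr_ge0 ?sqr_ge0 ?c_ge0.
have mh xi : measurable_fun D (h xi).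
  rewrite /h; case: asboolP => // Ixi; under eq_fun do rewrite EFinM.
  by apply: measurable_funeM; exact/measurable_cabs2/u_meas.
pose g N x := (\sum_(xi <- E N) h xi x)%E.
have gE N x : g N x = (\sum_(xi <- E N) c xi * cabs (u xi x) ^+ 2)%:E.
  rewrite /g -sumEFin big_seq [RHS]big_seq; apply: eq_bigr => xi /(@E_sub N) Ixi.
  by rewrite /h asboolT.
have mg N : measurable_fun D (g N) by exact: emeasurable_sum.
have g0 N x : D x -> (0 <= g N x)%E by move=> _; apply: sume_ge0.
have ig N : (\int[mu]_(x in D) g N x <= S%:E)%E.
  rewrite ge0_integral_sum //; apply: (@le_trans _ _ (\sum_(xi <- E N) (c xi)%:E)%E).
    rewrite big_seq [leRHS]big_seq; apply: lee_sum => xi /(@E_sub N) Ixi.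
    under eq_integral do rewrite /h asboolT // EFinM.
    rewrite ge0_integralZl_EFin ?c_ge0 //; last 2 first.
    - by move=> x _; rewrite lee_fin sqr_ge0.
    - exact/measurable_cabs2/u_meas.
    by rewrite -[leRHS]mule1 lee_wpmul2l ?lee_fin ?c_ge0 ?u_norm.
  by rewrite sumEFin lee_fin.
pose l x := limn_einf (g^~ x).
have ml : measurable_fun D l by exact: measurable_limn_einf.
have gl N x : (g N x <= l x)%E.
  rewrite /l limn_einf_lim; apply: lime_ge; first exact: is_cvg_einfs.
  exists N => // j /= Nj; apply: le_ereal_inf_tmp => _ [i /= ji <-].
  rewrite !gE lee_fin (sum_fsetD _ (E_mono (leq_trans Nj ji))) lerDl big_seq.
  apply: sumr_ge0 => xi; rewrite in_fsetD => /andP[_ /(@E_sub i) Ixi].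
  by rewrite mulr_ge0 ?sqr_ge0 ?c_ge0.
have l0 x : (0 <= l x)%E by apply: le_trans (gl 0%N x); apply: sume_ge0.
have il : (\int[mu]_(x in D) l x <= S%:E)%E.
  apply: le_trans (fatou mu mD mg g0) _.
  by apply: (@limn_einf_le _ _ _ 0) => j _; exact: ig.
have : mu.-integrable D l.
  apply/integrableP; split=> //; under eq_integral do rewrite gee0_abs //.
  by apply: le_lt_trans il _; exact: ltry.
move=> /(integrable_ae mD); apply: filterS => x lx Dx; exists (fine (l x)) => N.
by rewrite -lee_fin fineK ?lx // -gE.
Qed.

End AlmostEverywhereSummable.

(** * The estimate for symbols bounded in C^k *)

Lemma compact_closure_bounded (R : realType) n (D : set 'rV[R]_n) :
  bounded_set D -> compact (closure D).
Proof.
move=> [M [Mreal DM]]; apply: bounded_closed_compact; last exact: closed_closure.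
exists (`|M| + 2); split; first exact: num_real.
move=> e Me x Dx; have [y [Dy xy]] := Dx _ (nbhsx_ballx x 1 ltr01).
move: xy; rewrite -ball_normE /= => xy.
have yM : `|y| <= `|M| + 1.
  by apply: DM Dy; rewrite (le_lt_trans (ler_norm M)) // ltrDl.
have -> : x = (x - y) + y by rewrite subrK.
apply: le_trans (ler_normD _ _) _; lra.
Qed.

Lemma exists_fine_grid (R : realType) (a gap : R) : 0 < a -> 0 < gap ->
  exists2 N : nat, (0 < N)%N & a / N%:R < gap.
Proof.
move=> a0 g0; exists (Num.truncn (a / gap)).+1 => //.
rewrite ltr_pdivrMr // mulrC -ltr_pdivrMr //.
by have /andP[] := truncn_itv (ltW (divr_gt0 a0 g0)).
Qed.

Section BoundedSymbol.
Variables (R : realType) (n k : nat) (Omega : set 'rV[R]_n) (Xi : choiceType) (I : set Xi).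
Variables (u : Xi -> 'rV[R]_n -> R[i]) (a : 'rV[R]_n -> Xi -> R[i]).
Hypotheses (Omega_open : open Omega) (Omega_bounded : bounded_set Omega).
Hypothesis k_gt : (n < 2 * k)%N.
Hypothesis u_riesz : riesz_basis Omega I u.
Hypothesis u_norm : forall xi, I xi -> L2norm Omega (u xi) = 1.
Hypothesis a_bounded : bounded_in_Ck I k (closure Omega) a.
Local Notation mu := (lebesgue_rV R n).

Let mOmega : measurable Omega := open_measurable_rV Omega_open.

Lemma multi_partial0 (f : 'rV[R]_n -> R[i]) : multi_partial (fun=> 0%N) f = f.
Proof. by rewrite /multi_partial; elim: (enum 'I_n). Qed.

Lemma bounded_in_Ck_le : exists2 M : R, 0 <= M &
  forall x xi, closure Omega x -> I xi -> cabs (a x xi) <= M.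
Proof.
have [U [b [M [_ FU ba _ bM]]]] := a_bounded; exists `|M| => // x xi cx Ixi.
rewrite -ba //; apply: le_trans (ler_norm M); rewrite -[b x xi]/((b^~ xi) x).
by rewrite -[b^~ xi]multi_partial0 bM // ?/mi_size ?big1 //; exact: FU.
Qed.

Lemma cmeasurable_bounded_in_Ck xi : I xi -> cmeasurable Omega (a^~ xi).
Proof.
move=> Ixi; have [U [b [M [oU FU ba Cb _]]]] := a_bounded.
have OU x : Omega x -> U x by move=> Ox; apply/FU/subset_closure.
apply: (@eq_cmeasurable _ _ _ _ (b^~ xi)).
  by move=> x; rewrite inE => Ox; apply: ba => //; exact: subset_closure.
have [Cr Ci] := Cb xi Ixi; split; apply: continuous_measurable_rV => // x /OU Ux.
  by case: (k) Cr => [|k'] [+ _]; apply.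
by case: (k) Ci => [|k'] [+ _]; apply.
Qed.

(** The real and the imaginary part of the symbol are interpolated separately; an
    imaginary part is absorbed into the coefficients as a factor ['i]. *)
Lemma bounded_symbol_form : exists2 kappa : R, 0 <= kappa &
  forall (s : {fset Xi}) (c : Xi -> R[i]), [set` s] `<=` I ->
  (sqint mu Omega (fun x => (\sum_(xi <- s) u xi x * a x xi * c xi)%R) <=
    (kappa * \sum_(xi <- s) cabs (c xi) ^+ 2)%:E)%E.
Proof.
have k_gt0 : (0 < k)%N by case: (k) k_gt => //; rewrite muln0.
have [uL2 _ [alpha [beta [_ beta0 Hbeta]]]] := u_riesz.
have [U [b [M [oU FU ba Cb bM]]]] := a_bounded.
have OU x : Omega x -> U x by move=> Ox; apply/FU/subset_closure.
have [rho rho0 Orho] := bounded_set_coord Omega_bounded.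
have [gap gap0 Hgap] := compact_open_gap (compact_closure_bounded Omega_bounded) oU FU.
have Ogap (x y : 'rV_n) : Omega x -> (forall i, `|x ord0 i - y ord0 i| < gap) -> U y.
  by move=> /subset_closure; exact: Hgap.
have [N N0 HN] := exists_fine_grid (mulr_gt0 (ltr0n _ 2) rho0) gap0.
have [B B1 HB] := lagr_bounded R k.
have bder i xi x : I xi -> U x ->
    cabs (iter k (cpartial i) (b^~ xi) x) <= `|M|.
  move=> Ixi Ux; rewrite -multi_partial_pure; apply: le_trans (ler_norm M).
  by apply: bM => //; rewrite mi_size_pure.
have bval xi x : I xi -> U x -> cabs (b x xi) <= `|M|.
  move=> Ixi Ux; apply: le_trans (ler_norm M).
  have := bM (fun=> 0%N) x xi; rewrite multi_partial0; apply=> //.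
  by rewrite /mi_size big1.
pose eta2 := total_bound n k rho N B `|M| beta ^+ 2.
exists (2 * (eta2 + eta2)); first by rewrite mulr_ge0 // addr_ge0 // sqr_ge0.
move=> s c sI.
have mu_u xi : xi \in enum_fset s -> cmeasurable Omega (u xi).
  by move=> /sI Ixi; exact/L2_cmeasurable/uL2.
have bes c' : (sqint mu Omega (fun x => (\sum_(xi <- s) c' xi * u xi x)%R) <=
    (beta * \sum_(xi <- s) cabs (c' xi) ^+ 2)%:E)%E.
  rewrite sqint_L2norm; last by apply: L2_sum => // xi /sI; exact: uL2.
  by rewrite lee_fin; have /andP[_] := Hbeta s c' sI.
have nor xi : xi \in enum_fset s -> (sqint mu Omega (u xi) <= 1%:E)%E.
  by move=> /sI Ixi; rewrite sqint_L2norm ?u_norm ?expr1n //; exact: uL2.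
have [mr br] := symbol_bound_multiscale k_gt0 k_gt rho0 Orho Ogap N0 HN B1 HB
  Omega_open (ltW beta0) mu_u bes nor
  (g := fun xi => @complex.Re R \o b^~ xi)
  (fun xi sxi => (Cb xi (sI _ sxi)).1)
  (fun xi i x sxi Ux => ltac:(rewrite -Re_iter_cpartial;
     exact: le_trans (Re_le_cabs _) (bder i _ _ (sI _ sxi) Ux)))
  (fun xi x sxi Ux => le_trans (Re_le_cabs _) (bval _ _ (sI _ sxi) Ux)).
have [mi bi] := symbol_bound_multiscale k_gt0 k_gt rho0 Orho Ogap N0 HN B1 HB
  Omega_open (ltW beta0) mu_u bes nor
  (g := fun xi => @complex.Im R \o b^~ xi)
  (fun xi sxi => (Cb xi (sI _ sxi)).2)
  (fun xi i x sxi Ux => ltac:(rewrite -Im_iter_cpartial;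
     exact: le_trans (Im_le_cabs _) (bder i _ _ (sI _ sxi) Ux)))
  (fun xi x sxi Ux => le_trans (Im_le_cabs _) (bval _ _ (sI _ sxi) Ux)).
pose F (g : 'rV[R]_n -> Xi -> R) (c : Xi -> R[i]) x :=
  \sum_(xi <- s) c xi * (g x xi)%:C%C * u xi x.
pose re x xi := complex.Re (b x xi); pose im x xi := complex.Im (b x xi).
pose ci xi := c xi * 'i%C.
rewrite (@eq_sqint _ _ _ mu Omega _ (fun x => F re c x + F im ci x)); last first.
  move=> x; rewrite inE => Ox; rewrite -big_split /= big_seq [RHS]big_seq.
  apply: eq_bigr => xi /sI Ixi; rewrite -ba //; last exact: subset_closure.
  by rewrite [in LHS](complexE (b x xi)) /ci /re /im; ring.
have mF g c' : (forall xi, xi \in enum_fset s -> measurable_fun Omega (g^~ xi)) ->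
    cmeasurable Omega (F g c').
  by move=> mg; exact: (cmeasurable_symbol mOmega mu_u c' mOmega (@subset_refl _ Omega) mg).
apply: le_trans (sqintD mu mOmega (mF _ _ mr) (mF _ _ mi)) _.
rewrite -mulrA EFinM lee_wpmul2l ?lee_fin // mulrDl EFinD leeD //.
  exact: br.
apply: le_trans (bi ci) _; rewrite lee_fin ler_wpM2l ?sqr_ge0 //.
apply: ler_sum => xi _; rewrite /ci cabsM.
by rewrite (_ : cabs 'i%C = 1) ?mulr1 // /cabs /= expr0n expr1n add0r sqrtr1.
Qed.

End BoundedSymbol.

(** * The extension to L^2 *)

Section Extension.
Variables (R : realType) (n : nat) (Omega : set 'rV[R]_n) (Xi : countType) (I : set Xi).
Variables (u v : Xi -> 'rV[R]_n -> R[i]) (a : 'rV[R]_n -> Xi -> R[i]) (kappa beta : R).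
Hypothesis mOmega : measurable Omega.
Hypotheses (kappa_ge0 : 0 <= kappa) (beta_gt0 : 0 < beta).
Hypothesis a_meas : forall xi, I xi -> cmeasurable Omega (a^~ xi).
Hypothesis u_L2 : forall xi, I xi -> L2 Omega (u xi).
Hypothesis v_L2 : forall xi, I xi -> L2 Omega (v xi).
Local Notation X := 'rV[R]_n.
Local Notation mu := (lebesgue_rV R n).
Local Notation E := (code_exhaustion I).
Local Notation coef := (fourier_coeff Omega v).

Definition partial_sum (s : {fset Xi}) (f : X -> R[i]) (x : X) : R[i] :=
  \sum_(xi <- s) u xi x * a x xi * coef f xi.

Hypothesis form_le : forall (s : {fset Xi}) (c : Xi -> R[i]), [set` s] `<=` I ->
  (sqint mu Omega (fun x => (\sum_(xi <- s) u xi x * a x xi * c xi)%R) <=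
    (kappa * \sum_(xi <- s) cabs (c xi) ^+ 2)%:E)%E.
Hypothesis v_riesz : forall (s : {fset Xi}) c, [set` s] `<=` I ->
  L2norm Omega (finite_comb v s c) ^+ 2 <= beta * (\sum_(xi <- s) cabs (c xi) ^+ 2).

Let E_sub := @code_exhaustion_sub Xi I.
Let E_mono := @code_exhaustion_mono Xi I.
Let E_exh := @code_exhaustion_exh Xi I.

Lemma cmeasurable_partial_sum N f : cmeasurable Omega (partial_sum (E N) f).
Proof.
apply: cmeasurable_sum => xi /(@E_sub N) Ixi; apply: cmeasurableM.
  by apply: cmeasurableM; [exact/L2_cmeasurable/u_L2|exact: a_meas].
exact: cmeasurable_cst.
Qed.

Lemma sum_fourier_coeff_le (s : {fset Xi}) f : [set` s] `<=` I -> L2 Omega f ->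
  \sum_(xi <- s) cabs (coef f xi) ^+ 2 <= beta * L2norm Omega f ^+ 2.
Proof.
move=> sI lf; apply: bessel => //; first by move=> xi /sI; exact: v_L2.
by move=> c; exact: v_riesz.
Qed.

(** The difference of two partial sums is the partial sum over the difference of
    the sets, so it is controlled by a tail of the square sum of the
    coefficients. *)
Lemma partial_sum_limit f : L2 Omega f -> exists g, cmeasurable Omega g /\
  mean_square_limit mu Omega (fun N => partial_sum (E N) f) g.
Proof.
move=> lf.
have [N||g mg lg] := @mean_square_complete _ _ _ mu Omega mOmega
  (fun N => partial_sum (E N) f); [exact: cmeasurable_partial_sum| |by exists g].
move=> e e0; have e1 : 0 < e / (kappa + 1) by rewrite divr_gt0 // ltr_wpDl.
have [N HN] := summable_tail E_sub E_exh
  (w := fun xi => cabs (coef f xi) ^+ 2) (fun xi _ => sqr_ge0 _)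
  (fun N => sum_fourier_coeff_le (E_sub (N := N)) lf) e1.
suff H p q : (N <= p)%N -> (p <= q)%N ->
    (sqint mu Omega (fun x => (partial_sum (E q) f x - partial_sum (E p) f x)%R) <= e%:E)%E.
  exists N => p q Np Nq; case: (leqP p q) => [pq|/ltnW qp]; last exact: H.
  by rewrite sqint_distC; exact: H.
move=> Np pq; have EqpI : [set` (E q `\` E p)%fset] `<=` I.
  by move=> x /=; rewrite in_fsetD => /andP[_ /(@E_sub q)].
rewrite (@eq_sqint _ _ _ _ _ _ (partial_sum (E q `\` E p)%fset f)); last first.
  by move=> x _; rewrite /partial_sum (sum_fsetD _ (E_mono pq)) addrAC subrr add0r.
apply: le_trans (form_le _ EqpI) _; rewrite lee_fin.
have dis : [disjoint (E q `\` E p)%fset & E N]%fset.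
  apply/fdisjointP => x; rewrite in_fsetD => /andP[xp _].
  by apply: contra xp; exact: (fsubsetP (E_mono Np)).
apply: le_trans (ler_wpM2l kappa_ge0 (HN _ EqpI dis)) _.
rewrite mulrCA ler_piMr ?(ltW e0) // ler_pdivrMr; last by rewrite ltr_wpDl.
by rewrite mul1r lerDl.
Qed.

(** The partial sums depend on [f] only through its coefficients, so choosing a
    limit as a function of the sequence of partial sums makes the extension
    constant on almost everywhere equal functions. *)
Definition extension (f : X -> R[i]) : X -> R[i] :=
  xget (fun=> 0) [set g | cmeasurable Omega g /\
    mean_square_limit mu Omega (fun N => partial_sum (E N) f) g].

Lemma extensionP f : L2 Omega f -> cmeasurable Omega (extension f) /\
  mean_square_limit mu Omega (fun N => partial_sum (E N) f) (extension f).
Proof. by move=> /partial_sum_limit; exact: xgetPex. Qed.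

Lemma sqint_extension_le f : L2 Omega f -> (sqint mu Omega (extension f) <=
  (2 * (kappa * (beta * L2norm Omega f ^+ 2)))%:E)%E.
Proof.
move=> lf; have [mT lT] := extensionP lf.
apply: (mean_square_limit_le mOmega (cmeasurable_partial_sum^~ f) mT lT) => N.
apply: le_trans (form_le _ (E_sub (N := N))) _.
by rewrite lee_fin ler_wpM2l // sum_fourier_coeff_le //; exact: E_sub.
Qed.

Lemma extension_L2 f : L2 Omega f -> L2 Omega (extension f).
Proof.
move=> lf; apply/L2P; split; first by have [] := extensionP lf.
by apply: le_lt_trans (sqint_extension_le lf) _; exact: ltry.
Qed.

Lemma extension_ae f g : L2 Omega f -> L2 Omega g -> eqae Omega f g ->
  extension f = extension g.
Proof.
move=> lf lg fg.
suff EP : (fun N => partial_sum (E N) f) = (fun N => partial_sum (E N) g).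
  by rewrite /extension EP.
apply/funext => N; apply/funext => x; rewrite /partial_sum big_seq [RHS]big_seq.
apply: eq_bigr => xi /(@E_sub N) Ixi; congr (_ * _).
by apply: L2inner_ae => //; [exact: v_L2|exact: v_L2|exact: aeW].
Qed.

Lemma extension_lin (z : R[i]) f g : L2 Omega f -> L2 Omega g ->
  eqae Omega (extension (fun x => z * f x + g x)) (fun x => z * extension f x + extension g x).
Proof.
move=> lf lg.
have [mf limf] := extensionP lf; have [mg limg] := extensionP lg.
have [mh limh] := extensionP (L2_lin mOmega z lf lg).
apply: (mean_square_limit_unique mOmega (cmeasurable_partial_sum^~ _) mh _ limh).
  by apply: cmeasurableD => //; exact: cmeasurableZ.
have := mean_square_limit_lin mOmega z (cmeasurable_partial_sum^~ f)
  (cmeasurable_partial_sum^~ g) mf mg limf limg.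
congr (mean_square_limit _ _ _ _); apply/funext => N; apply/funext => x.
rewrite /partial_sum mulr_sumr -big_split big_seq [RHS]big_seq.
apply: eq_bigr => xi /(@E_sub N) Ixi /=.
by rewrite /fourier_coeff L2inner_lin //; [ring|exact: v_L2].
Qed.

Lemma extension_bounded : bounded_operator Omega extension.
Proof.
split.
  split=> //.
  - exact: extension_L2.
  - by move=> f g lf lg fg; split=> //; rewrite (extension_ae lf lg fg); exact: aeW.
  - exact: L2_0.
  - by move=> z f g lf lg; split; [exact: L2_lin|exact: extension_lin].
exists (Num.sqrt (2 * (kappa * beta))) => f lf.
have kb : 0 <= 2 * (kappa * beta) by rewrite !mulr_ge0 // ltW.
have norm_ge0 g : 0 <= L2norm Omega g by exact: sqrtr_ge0.
rewrite -ler_sqr ?nnegrE //; last by rewrite mulr_ge0 ?sqrtr_ge0.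
rewrite exprMn (sqr_sqrtr kb).
have -> : 2 * (kappa * beta) * L2norm Omega f ^+ 2 =
    2 * (kappa * (beta * L2norm Omega f ^+ 2)) by ring.
by rewrite -lee_fin -sqint_L2norm; [exact: sqint_extension_le|exact: extension_L2].
Qed.

(** If the coefficients of [f] are summable, then so is almost everywhere the
    series of the [cabs (coef f xi) * (1 + cabs (u xi x) ^+ 2)], which dominates
    the series defining the operator. *)
Lemma extension_has_sum f (w : Xi -> R) (S M : R) : L2 Omega f -> 0 <= M ->
  (forall xi, I xi -> L2norm Omega (u xi) = 1) ->
  (forall x xi, Omega x -> I xi -> cabs (a x xi) <= M) ->
  (forall xi, I xi -> cabs (coef f xi) <= w xi) ->
  (forall N, \sum_(xi <- E N) w xi <= S) ->
  is_Op Omega I u v a f (extension f).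
Proof.
move=> lf M0 u_norm aM cw wS.
have w0 xi : I xi -> 0 <= w xi by move=> /cw; apply: le_trans; exact: cabs_ge0.
have usum : {ae mu, forall x, Omega x -> exists B : R, forall N,
    \sum_(xi <- E N) w xi * cabs (u xi x) ^+ 2 <= B}.
  apply: (ae_summable mOmega E_sub E_mono w0 wS).
  - by move=> xi Ixi; exact/L2_cmeasurable/u_L2.
  - by move=> xi Ixi; rewrite sqint_L2norm ?u_norm ?expr1n //; exact: u_L2.
have hsum : {ae mu, forall x, Omega x -> exists z,
    has_sum I (fun xi => u xi x * a x xi * coef f xi) z /\
    ccvg (fun N => partial_sum (E N) f x) z}.
  apply: filterS usum => x ux Ox; have [B HB] := ux Ox.
  pose wx xi := M * (w xi + w xi * cabs (u xi x) ^+ 2).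
  have tw xi : I xi -> cabs (u xi x * a x xi * coef f xi) <= wx xi.
    move=> Ixi; rewrite !cabsM [cabs (u xi x) * _]mulrC -mulrA ler_pM ?mulr_ge0 ?cabs_ge0 //.
      exact: aM.
    apply: (@le_trans _ _ (cabs (u xi x) * w xi)).
      by rewrite ler_wpM2l ?cabs_ge0 // cw.
    rewrite -[X in _ <= X + _]mulr1 -mulrDr mulrC ler_wpM2l ?w0 //.
    have := sqr_ge0 (cabs (u xi x) - 1); have := cabs_ge0 (u xi x); nra.
  have wxS N : \sum_(xi <- E N) wx xi <= M * (S + B).
    by rewrite -mulr_sumr ler_wpM2l // big_split lerD //=.
  by have [z z1 z2] := has_sum_exhaustion E_sub E_mono E_exh tw wxS; exists z.
pose G x := xget 0 [set z | has_sum I (fun xi => u xi x * a x xi * coef f xi) z /\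
    ccvg (fun N => partial_sum (E N) f x) z].
have GP : {ae mu, forall x, Omega x ->
    has_sum I (fun xi => u xi x * a x xi * coef f xi) (G x) /\
    ccvg (fun N => partial_sum (E N) f x) (G x)}.
  by apply: filterS hsum => x hx Ox; exact: xgetPex (hx Ox).
have [mT lT] := extensionP lf.
have TG : {ae mu, forall x, Omega x -> extension f x = G x}.
  apply: (mean_square_limit_ae mOmega (cmeasurable_partial_sum^~ f) mT lT).
  by apply: filterS GP => x gx Ox; have [] := gx Ox.
apply: filterS2 TG GP => x tg gp Ox; rewrite tg //.
by have [] := gp Ox.
Qed.

End Extension.

Lemma sum_fset_le_esum (R : realType) (Xi : choiceType) (I : set Xi) (w : Xi -> R)
    (s : {fset Xi}) : [set` s] `<=` I ->
  ((\sum_(xi <- s) w xi)%:E <= \esum_(xi in I) (w xi)%:E)%E.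
Proof.
move=> sI; apply: esum_ge; exists [set` s]; first by split; [exact: finite_fset|].
by rewrite -sumEFin fsbig_seq ?fset_uniq.
Qed.

Theorem theorem14p1 (R : realType) (n m K : nat)
    (Omega : set 'rV[R]_n) (L : operator R n)
    (I : set 'rV[int]_K) (lambda : 'rV[int]_K -> R[i])
    (u v : 'rV[int]_K -> 'rV[R]_n -> R[i])
    (n_gt0 : (0 < n)%N) (m_gt0 : (0 < m)%N)
    (Omega_open : open Omega) (Omega_bounded : bounded_set Omega)
    (L_linear : linear_operator Omega L)
    (L_diff : differential_operator Omega m L)
    (L_spectrum : discrete_spectrum Omega I L lambda u)
    (lambda_order : forall j k, I j -> I k ->
      latt_norm R j <= latt_norm R k -> cabs (lambda j) <= cabs (lambda k))
    (u_eigen : eigenfunctions Omega I L lambda u)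
    (v_eigen : eigenfunctions Omega I (adjoint Omega L)
                 (fun xi => (lambda xi)^*%C) v)
    (uv_biorthonormal : biorthonormal Omega I u v)
    (u_riesz : riesz_basis Omega I u) (v_riesz : riesz_basis Omega I v)
    (bracket_summable : exists s0 : R,
      (\esum_(xi in I) (japanese m (lambda xi) `^ (- s0))%:E < +oo)%E)
    (L_complete : Cinfty_complete Omega L)
    (Ladj_complete : Cinfty_complete Omega (adjoint Omega L))
    (wz : WZ m Omega I lambda u v)
    (k : nat) (k_gt : (n < 2 * k)%N)
    (a : 'rV[R]_n -> 'rV[int]_K -> R[i])
    (a_bounded : bounded_in_Ck I k (closure Omega) a) :
  exists2 T : ('rV[R]_n -> R[i]) -> ('rV[R]_n -> R[i]),
    bounded_operator Omega T &
    forall f, Cinfty Omega L f -> is_Op Omega I u v a f (T f).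
Proof.
have mOmega := open_measurable_rV Omega_open.
have [u_norm _] := uv_biorthonormal.
have [u_L2 _ _] := u_riesz.
have [v_L2 _ [alpha [beta [_ beta0 Hbeta]]]] := v_riesz.
have v_up (s : {fset 'rV[int]_K}) c : [set` s] `<=` I ->
    L2norm Omega (finite_comb v s c) ^+ 2 <= beta * (\sum_(xi <- s) cabs (c xi) ^+ 2).
  by move=> sI; have /andP[] := Hbeta s c sI.
have [kappa kappa0 Hkappa] := bounded_symbol_form Omega_open Omega_bounded
  k_gt u_riesz u_norm a_bounded.
have a_meas xi : I xi -> cmeasurable Omega (a^~ xi).
  exact: cmeasurable_bounded_in_Ck Omega_open a_bounded _.
have [M M0 aM] := bounded_in_Ck_le a_bounded.
exists (extension Omega I u v a); first exact: extension_bounded Hkappa v_up.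
move=> f Cf; have lf : L2 Omega f by case: Cf.
have [s0 Hs0] := bracket_summable.
have [C HC] := fourier_coeff_decay mOmega m_gt0 L_linear v_eigen beta0 v_L2 v_up s0 Cf.
pose w xi := japanese m (lambda xi) `^ (- s0).
have w0 xi : 0 <= w xi by exact: powR_ge0.
have sumw N : \sum_(xi <- code_exhaustion I N) `|C| * w xi <=
    `|C| * fine (\esum_(xi in I) (w xi)%:E)%E.
  rewrite -mulr_sumr ler_wpM2l // -lee_fin fineK.
    exact: (sum_fset_le_esum w (@code_exhaustion_sub _ I N)).
  by rewrite ge0_fin_numE // esum_ge0 // => xi _; rewrite lee_fin w0.
apply: (extension_has_sum mOmega kappa0 beta0 a_meas u_L2 v_L2 Hkappa v_up lf M0 u_norm _ _ sumw).
  by move=> x xi Ox; apply: aM; exact: subset_closure.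
move=> xi /HC /le_trans; apply; apply: ler_wpM2r; [exact: w0|exact: ler_norm].
Qed.
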